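(* Let $s\in(0,1)$, $N>2s$, $c\in L^\infty_{\mathrm{loc}}(\mathbb{R}^N)$, and let $u\in\dot H^s(\mathbb{R}^N)$ be a weak supersolution to $$(-\Delta)^su+c(x)u=0,\quad x\in\mathbb{R}^N.$$ If $u\in C(\mathbb{R}^N)$ and $u\ge0$ in $\mathbb{R}^N$, then either $u\equiv0$ in $\mathbb{R}^N$ or $u>0$ in $\mathbb{R}^N$.
   Context: $\dot H^s(\mathbb{R}^N)=\{u\in L^{2N/(N-2s)}(\mathbb{R}^N):\iint_{\mathbb{R}^{2N}}\frac{|u(x)-u(y)|^2}{|x-y|^{N+2s}}\,dx\,dy<\infty\}$. Weak supersolution means $$\iint_{\mathbb{R}^{2N}}\frac{(u(x)-u(y))(\varphi(x)-\varphi(y))}{|x-y|^{N+2s}}\,dx\,dy+\int_{\mathbb{R}^N}c\,u\,\varphi\ge0$$ for all nonnegative $\varphi\in\dot H^s(\mathbb{R}^N)$ with compact support. The convention is $(-\Delta)^su(x)=2\lim_{r\to0}\int_{\mathbb{R}^N\setminus B_r(x)}\frac{u(x)-u(y)}{|x-y|^{N+2s}}\,dy$. *)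

(* Defs.v *)
From HB Require Import structures.
From mathcomp Require Import all_boot all_order all_algebra.
From mathcomp Require Import all_classical all_reals all_analysis.

Set Implicit Arguments.
Unset Strict Implicit.
Unset Printing Implicit Defensive.

Import Order.TTheory GRing.Theory Num.Theory.
Import numFieldNormedType.Exports.

Local Open Scope classical_set_scope.
Local Open Scope ring_scope.

Definition measure_rV_display : measure_display.
Proof. exact: default_measure_display. Qed.

(* The sigma-algebra on R^n is the product one, generated by the coordinates
   (as for [n.-tuple R]); it is the Borel sigma-algebra of the topology of
   ['rV[R]_n]. *)
Section measurable_rV.
Context {R : realType} (n : nat).

Definition rV_coord (i : 'I_n) (x : 'rV[R]_n) : measurableTypeR R := x ord0 i.

Let rV_set0 : g_sigma_preimage rV_coord set0.
Proof. exact: sigma_algebra0. Qed.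

Let rV_setC A : g_sigma_preimage rV_coord A -> g_sigma_preimage rV_coord (~` A).
Proof. exact: sigma_algebraC. Qed.

Let rV_bigcup (F : _^nat) : (forall i, g_sigma_preimage rV_coord (F i)) ->
  g_sigma_preimage rV_coord (\bigcup_i (F i)).
Proof. exact: sigma_algebra_bigcup. Qed.

HB.instance Definition _ := @isMeasurable.Build measure_rV_display
  'rV[R]_n (g_sigma_preimage rV_coord) rV_set0 rV_setC rV_bigcup.

End measurable_rV.

Section rV_cons.
Context {R : realType}.

Lemma measurable_fun_rVP d (T : measurableType d) n (f : T -> 'rV[R]_n) :
  measurable_fun [set: T] f <->
  forall i, measurable_fun [set: T] (rV_coord i \o f).
Proof.
apply: (@iff_trans _ (g_sigma_preimage
    (fun i => rV_coord i \o f) `<=` measurable)).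
  rewrite g_sigma_preimage_comp; split=> [mf A [/= C preC <-]|prefS].
    exact: mf.
  by move=> _ A mA; apply: prefS; exists A.
split=> [fS i|mf].
- move=> _ A mA; apply: fS; apply: sub_sigma_algebra.
  case: n i => [[] []//|n i] in f *.
  rewrite -bigcup_mkord_ord.
  exists i; first exact: ltn_ord.
  by exists A => //; rewrite inord_val.
- apply: smallest_sub; first exact: sigma_algebra_measurable.
  case: n => [|n] in f mf *; first by rewrite big_ord0.
  rewrite -bigcup_mkord_ord; apply: bigcup_sub => i Ii.
  by move=> A [B mB <-]; exact: mf.
Qed.

Lemma measurable_rV_coord n (i : 'I_n) :
  measurable_fun [set: 'rV[R]_n] (rV_coord i).
Proof. by have /measurable_fun_rVP := @measurable_id _ 'rV[R]_n setT; exact. Qed.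

Definition rV_cons n (p : measurableTypeR R * 'rV[R]_n) : 'rV[R]_n.+1 :=
  \row_(i < n.+1) if unlift ord0 i is Some j then p.2 ord0 j else p.1.

Definition rV_uncons n (x : 'rV[R]_n.+1) : measurableTypeR R * 'rV[R]_n :=
  (x ord0 ord0, \row_j x ord0 (lift ord0 j)).

Lemma rV_uncons_cons n : cancel (@rV_cons n) (@rV_uncons n).
Proof.
move=> [a y]; rewrite /rV_uncons /rV_cons mxE unlift_none; congr pair.
by apply/rowP => j; rewrite !mxE liftK.
Qed.

Lemma measurable_rV_cons n : measurable_fun setT (@rV_cons n).
Proof.
apply/measurable_fun_rVP => i; case: (unliftP ord0 i) => [j ->|->].
- have -> : rV_coord (lift ord0 j) \o @rV_cons n = rV_coord j \o snd.
    by apply/funext => p /=; rewrite /rV_coord mxE liftK.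
  by apply: measurableT_comp; [exact: measurable_rV_coord|exact: measurable_snd].
- have -> : rV_coord ord0 \o @rV_cons n = fst.
    by apply/funext => p /=; rewrite /rV_coord mxE unlift_none.
  exact: measurable_fst.
Qed.

Lemma measurable_rV_uncons n : measurable_fun setT (@rV_uncons n).
Proof.
apply/measurable_fun_pairP; split; first exact: (@measurable_rV_coord n.+1 ord0).
apply/measurable_fun_rVP => i.
have -> : rV_coord i \o (snd \o @rV_uncons n) = rV_coord (lift ord0 i).
  by apply/funext => p /=; rewrite /rV_coord mxE.
exact: measurable_rV_coord.
Qed.

End rV_cons.

Section lebesgue_rV_step.
Context {R : realType} (n : nat).
Variable m : {sigma_finite_measure set 'rV[R]_n -> \bar R}.
Local Open Scope ereal_scope.

Let mcons := @measurable_rV_cons R n.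

Let push : set 'rV[R]_n.+1 -> \bar R :=
  pushforward (@lebesgue_measure R \x m) (@rV_cons R n).

Let push0 : push set0 = 0. Proof. exact: measure0. Qed.

Let push_ge0 A : 0 <= push A. Proof. exact: measure_ge0. Qed.

Let push_sigma_additive : semi_sigma_additive push.
Proof. exact: measure_semi_sigma_additive. Qed.

HB.instance Definition _ :=
  isMeasure.Build _ _ _ push push0 push_ge0 push_sigma_additive.

Let push_sigma_finite : sigma_finite setT push.
Proof.
have /sigma_finiteP[F [TF ndF Foo]] := sigma_finiteT (@lebesgue_measure R).
have /sigma_finiteP[G [TG ndG Goo]] := sigma_finiteT m.
exists (fun k => @rV_uncons R n @^-1` (F k `*` G k)).
  apply/esym/seteqP; split => // x _.
  have [i _ Fi] : (\bigcup_i F i) (rV_uncons x).1 by rewrite -TF.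
  have [j _ Gj] : (\bigcup_i G i) (rV_uncons x).2 by rewrite -TG.
  exists (maxn i j) => //; split.
  - by move: Fi; exact/subsetPset/ndF/leq_maxl.
  - by move: Gj; exact/subsetPset/ndG/leq_maxr.
move=> k; have [mFk Fk] := Foo k; have [mGk Gk] := Goo k; split.
  rewrite -[X in measurable X]setTI; apply: measurable_rV_uncons => //.
  exact: measurableX.
rewrite /push /pushforward -comp_preimage.
have -> : @rV_uncons R n \o @rV_cons R n = id.
  by apply/funext => p /=; exact: rV_uncons_cons.
by rewrite preimage_id product_measure1E// lte_mul_pinfty// ge0_fin_numE.
Qed.

HB.instance Definition _ :=
  Measure_isSigmaFinite.Build _ _ _ push push_sigma_finite.

Definition lebesgue_rV_step : {sigma_finite_measure set 'rV[R]_n.+1 -> \bar R} :=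
  push.

End lebesgue_rV_step.

Section lebesgue_rV.
Context {R : realType}.
Local Open Scope ereal_scope.

(* Lebesgue measure on R^n, as an iterated product of [lebesgue_measure];
   see [lebesgue_rV_box]. *)
Fixpoint lebesgue_rV (n : nat) : {sigma_finite_measure set 'rV[R]_n -> \bar R} :=
  match n with
  | 0 => \d_(0%R : 'rV[R]_0)
  | n'.+1 => lebesgue_rV_step (lebesgue_rV n')
  end.

Lemma lebesgue_rV_box n (A : 'I_n -> set (measurableTypeR R)) :
  (forall i, measurable (A i)) ->
  lebesgue_rV n [set x | forall i, A i (x ord0 i)] =
  \prod_(i < n) lebesgue_measure (A i).
Proof.
elim: n A => [|n IHn] A mA.
  by rewrite big_ord0 /= diracE mem_set// => -[].
rewrite big_ord_recl -IHn => [|i]; last exact: mA.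
have mB : measurable [set x : 'rV[R]_n | forall i, A (lift ord0 i) (x ord0 i)].
  have -> : [set x : 'rV[R]_n | forall i, A (lift ord0 i) (x ord0 i)] =
      \bigcap_(i in setT) (@rV_coord R n i @^-1` A (lift ord0 i)).
    by apply/seteqP; split => x /= Ax i; [move=> _|]; exact: Ax.
  apply: fin_bigcap_measurable => [|i _]; first exact: finite_finset.
  by rewrite -[X in measurable X]setTI; exact: measurable_rV_coord.
rewrite -product_measure1E//=.
congr (product_measure1 _ _ _); apply/seteqP; split => [p /= Ap|p [A0 Ap] i /=].
- split=> [|i /=]; first by have := Ap ord0; rewrite mxE unlift_none.
  by have := Ap (lift ord0 i); rewrite mxE liftK.
- by rewrite mxE; case: unliftP => [j ->|->].
Qed.

End lebesgue_rV.

Section fractional_sobolev.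
Context {R : realType} (N : nat).
Local Notation mu := (@lebesgue_rV R N).

(* The norm of ['rV[R]_N] in the library is the sup norm. *)
Definition enorm (x : 'rV[R]_N) : R := Num.sqrt (\sum_(i < N) x ord0 i ^+ 2).

(* Functions representing an element of L^p: [Lfun] asks for Borel
   measurability, and being a.e. equal to a Borel function is the same as being
   Lebesgue measurable.  The integral of such a function is that of any of its
   Borel representatives, since the library integral of a nonnegative function
   is the supremum over the measurable simple functions below it. *)
Definition in_Lp (p : \bar R) (f : 'rV[R]_N -> R) : Prop :=
  exists2 g : 'rV[R]_N -> R, g \in Lfun mu p & f = g %[ae mu].

Definition in_Linfty_loc (f : 'rV[R]_N -> R) : Prop :=
  forall K : set 'rV[R]_N, compact K -> in_Lp +oo%E (f \* \1_K).

(* At x = y both kernels below are 0, as [0 `^ r = 0] for r != 0 and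
   [0^-1 = 0]; the diagonal is a null set anyway. *)
Definition homogeneous_sobolev (s : R) (u : 'rV[R]_N -> R) : Prop :=
  in_Lp (2 * N%:R / (N%:R - 2 * s))%:E u /\
  (\int[mu \x mu]_z
     (`|u z.1 - u z.2| ^+ 2 / enorm (z.1 - z.2) `^ (N%:R + 2 * s))%:E < +oo)%E.

Definition gagliardo_form (s : R) (u v : 'rV[R]_N -> R) : \bar R :=
  (\int[mu \x mu]_z
     ((u z.1 - u z.2) * (v z.1 - v z.2)
        / enorm (z.1 - z.2) `^ (N%:R + 2 * s))%:E)%E.

Definition weak_supersolution (s : R) (c u : 'rV[R]_N -> R) : Prop :=
  forall phi : 'rV[R]_N -> R,
    homogeneous_sobolev s phi ->
    (forall x, 0 <= phi x) ->
    compact (closure [set x | phi x != 0]) ->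
    (0 <= gagliardo_form s u phi + \int[mu]_x (c x * u x * phi x)%:E)%E.

End fractional_sobolev.

(* Main.v *)
Require Import Defs.
From mathcomp Require Import all_boot all_order all_algebra.
From mathcomp Require Import all_classical all_reals all_analysis.
From mathcomp Require Import measurable_realfun ess_sup_inf.
From mathcomp Require Import ring lra.

Set Implicit Arguments.
Unset Strict Implicit.
Unset Printing Implicit Defensive.

Import Order.TTheory GRing.Theory Num.Theory.
Import numFieldNormedType.Exports.

Local Open Scope classical_set_scope.
Local Open Scope ring_scope.

(** Suppose that [u] vanishes at [x0] and is positive at [y0].  The nonlocal operator
    sees the positive values of [u] near [y0] from the point [x0], and this forces
    the inequality of a supersolution to fail near [x0].

    To make this rigorous with only continuity of [u], compare [u] with the small
    truncated paraboloid eps * [bump], supported in a ball B around [x0] which is away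
    from a ball A around [y0], where u >= del.  The test function
    phi = max(0, eps * bump - u) ([excess]) is nonnegative, supported in B, of finite
    energy, and its integral is positive.  Writing v = eps * bump - u, so that phi is
    the positive part of v, the integrand (u x - u y) (phi x - phi y) is at most
    eps (bump x - bump y) (phi x - phi y) - del (1_A(y) phi(x) + 1_A(x) phi(y))
    ([excess_form_le]).  Three estimates then suffice.

    - The form of the bump against phi is at most a constant times the integral of
      phi.  For a smooth bump this says that its fractional Laplacian is bounded.
      Here the bound follows from semiconvexity ([bump_semiconvex]): truncate the
      kernel near the diagonal, use the symmetry in x and y to move the difference
      off phi, and replace the first difference of the bump by a second difference
      through the reflection y |-> 2x - y, which preserves Lebesgue measure
      ([integral_diff_ktrunc_le]).  Second differences are of order min(1, |x - y|^2),
      which the kernel integrates ([integral_min1_kern]).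

    - On B x A the kernel is bounded below by a positive constant, so the term with
      del contributes at most a negative constant times the integral of phi.

    - Where phi is positive, u is at most eps r^2, so the potential term is at most a
      constant times eps times the integral of phi ([potential_excess_le]).

    In total the left-hand side of the inequality tested with phi is at most
    (C eps - C' del) times the integral of phi with C' > 0, and this is negative for
    small eps ([supersolution_touching_zero]). *)

(** * The sup norm and measurability of continuous functions *)

Section rV_topology.
Context {R : realType} (n : nat).
Implicit Types (x y : 'rV[R]_n) (r : R).

Lemma rV_norm_leP x r : 0 <= r ->
  (`|x| <= r) <-> (forall i, `|x ord0 i| <= r).
Proof.
move=> r0; rewrite [X in X <= _]/Num.norm /= mx_normrE; split.
  move=> /bigmax_leP[_ h] i; exact: (h (ord0, i)).
by move=> h; apply/bigmax_leP; split=> // -[i j] _; rewrite (ord1 i); exact: h.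
Qed.

Lemma rV_coord_le_norm x i : `|x ord0 i| <= `|x|.
Proof. exact: (rV_norm_leP x (normr_ge0 x)).1. Qed.

Lemma measurable_rV_box (A : 'I_n -> set (measurableTypeR R)) :
  (forall i, measurable (A i)) ->
  measurable [set x : 'rV[R]_n | forall i, A i (x ord0 i)].
Proof.
move=> mA.
have -> : [set x : 'rV[R]_n | forall i, A i (x ord0 i)] =
    \bigcap_(i in setT) (@rV_coord R n i @^-1` A i).
  by apply/seteqP; split => x /= Ax i; [move=> _|]; exact: Ax.
apply: fin_bigcap_measurable => [|i _]; first exact: finite_finset.
by rewrite -[X in measurable X]setTI; exact: measurable_rV_coord.
Qed.

(** The sigma-algebra is generated by the coordinates, so openness of a preimage
    says nothing directly.  But [f] is the pointwise limit of its values at the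
    lower corners of the cells of the grids of mesh 1/(k+1), and each of these
    approximations takes countably many values, each on a union of cells. *)
Lemma continuous_measurable_rV (f : 'rV[R]_n -> R) :
  continuous f -> measurable_fun [set: 'rV[R]_n] f.
Proof.
move=> cf.
pose g (k : nat) (z : 'rV[int]_n) : 'rV[R]_n :=
  \row_i ((z ord0 i)%:~R / k.+1%:R).
pose q (k : nat) (x : 'rV[R]_n) : 'rV[int]_n :=
  \row_i Num.floor (x ord0 i * k.+1%:R).
apply: (@measurable_fun_cvg _ _ _ setT (fun k x => f (g k (q k x)))).
  move=> k _ B mB; rewrite setTI.
  have -> : (fun x => f (g k (q k x))) @^-1` B =
      \bigcup_(z in [set: 'rV[int]_n])
        (if `[< B (f (g k z)) >] then q k @^-1` [set z] else set0).
    apply/seteqP; split=> [x /= Bx|x [z _]].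
      by exists (q k x) => //; case: asboolP.
    by case: asboolP => //= Bz ->.
  apply: (countable_bigcupT_measurable (countableP _)) => z.
  case: asboolP => [_|_]; last exact: measurable0.
  have -> : q k @^-1` [set z] = [set x | forall i,
      [set t : measurableTypeR R | Num.floor (t * k.+1%:R) = z ord0 i]
        (x ord0 i)].
    apply/seteqP; split=> x /=; first by move=> <- i; rewrite mxE.
    by move=> h; apply/rowP => i; rewrite mxE h.
  apply: (@measurable_rV_box (fun i =>
    [set t | Num.floor (t * k.+1%:R) = z ord0 i])) => i.
  have -> : [set t : measurableTypeR R | Num.floor (t * k.+1%:R) = z ord0 i] =
      `[(z ord0 i)%:~R / k.+1%:R, (z ord0 i + 1)%:~R / k.+1%:R[%classic.
    apply/seteqP; split=> t /=; rewrite in_itv /= ler_pdivrMr // ltr_pdivlMr //.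
      by move=> <-; exact: floor_itv.
    exact: floor_def.
  exact: measurable_itv.
move=> x _; apply: cvg_comp; last exact: cf.
apply/cvgrPdist_le => e e0.
near=> k; apply/rV_norm_leP => [|i]; first exact: ltW.
rewrite !mxE /=.
have k0 : 0 < k.+1%:R :> R by [].
have /andP[h1 h2] := floor_itv (x ord0 i * k.+1%:R).
rewrite -ler_pdivrMr // in h1.
rewrite intrD /= -ltr_pdivlMr // mulrDl in h2.
rewrite ger0_norm ?subr_ge0 // lerBlDl (le_trans (ltW h2)) // lerD2l mul1r.
by near: k; apply: filterS (near_infty_natSinv_lt (PosNum e0)) => k /= /ltW.
Unshelve. all: end_near. Qed.

End rV_topology.

(** * Balls of the sup norm and reflections under Lebesgue measure *)

Section rV_measure.
Context {R : realType}.
Local Notation mu n := (@lebesgue_rV R n).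

Definition norm_ball n (x : 'rV[R]_n) (r : R) : set 'rV[R]_n :=
  [set y | `|x - y| <= r].

Lemma norm_ball_box n (x : 'rV[R]_n) r : 0 <= r ->
  norm_ball x r =
  [set y | forall i, `[x ord0 i - r, x ord0 i + r]%classic (y ord0 i)].
Proof.
move=> r0; apply/seteqP; split=> y /= => [/(rV_norm_leP _ r0) h i|h].
  by move: (h i); rewrite !mxE /= in_itv /= distrC ler_distl.
apply/rV_norm_leP => // i; move: (h i).
by rewrite !mxE /= in_itv /= distrC ler_distl.
Qed.

Lemma measurable_norm_ball n (x : 'rV[R]_n) r : measurable (norm_ball x r).
Proof.
have [r0|r0] := leP 0 r.
  rewrite norm_ball_box //.
  exact: (@measurable_rV_box _ _
    (fun i => `[x ord0 i - r, x ord0 i + r]%classic)).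
rewrite (_ : norm_ball x r = set0) //; apply/seteqP; split => // y /= h.
by move: (le_lt_trans h r0); rewrite normr_lt0.
Qed.

Lemma lebesgue_norm_ball n (x : 'rV[R]_n) r : 0 <= r ->
  mu n (norm_ball x r) = ((2 * r) ^+ n)%:E.
Proof.
move=> r0; rewrite norm_ball_box //.
rewrite (@lebesgue_rV_box _ _
  (fun i => `[x ord0 i - r, x ord0 i + r]%classic)) //.
rewrite (eq_bigr (fun=> (2 * r)%:E)) => [|i _].
  by rewrite prodEFin prodr_const card_ord.
rewrite lebesgue_measure_itv /= lte_fin -EFinD.
case: ltP => h; first by congr EFin; ring.
by congr EFin; lra.
Qed.

Let refl (a : R) (t : measurableTypeR R) : measurableTypeR R := a - t.

Let measurable_refl a : measurable_fun [set: measurableTypeR R] (refl a).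
Proof. exact: measurable_funB. Qed.

Let reflected a : {measure set (measurableTypeR R) -> \bar R} :=
  measure_function_pushforward__canonical__measure_function_Measure
    (@lebesgue_measure R) (measurable_refl a).

Let reflectedE a (A : set (measurableTypeR R)) : measurable A ->
  reflected a A = lebesgue_measure A.
Proof.
move=> mA; apply/esym.
apply: (@lebesgue_measure_unique R (reflected a)) => // _ [[p q]] _ <-.
have -> : reflected a `]p, q]%classic = lebesgue_measure `[a - q, a - p[%classic.
  congr lebesgue_measure; apply/seteqP.
  by split=> t /=; rewrite /refl !in_itv /=; lra.
rewrite !lebesgue_measure_itv /= !lte_fin ltrD2l ltrN2 -!EFinB.
by case: ifP => // _; congr EFin; ring.
Qed.

Lemma ge0_lebesgue_integral_reflect (a : R) (f : measurableTypeR R -> \bar R) :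
  measurable_fun setT f -> (forall t, 0 <= f t)%E ->
  (\int[lebesgue_measure]_t f (a - t)%R = \int[lebesgue_measure]_t f t)%E.
Proof.
move=> mf f0.
transitivity (\int[reflected a]_t f t)%E; last first.
  by apply: eq_measure_integral => A mA _; exact: reflectedE.
apply/esym; have f0' : {in [set: measurableTypeR R], forall t, 0 <= f t}%E by [].
exact: (ge0_integral_pushforward (measurable_refl a) _ measurableT mf f0').
Qed.

(** Lebesgue measure on R^(n+1) is the image of a product under [rV_cons]: this is
    Tonelli's theorem for splitting off the first coordinate. *)
Lemma ge0_integral_rV_cons n (f : 'rV[R]_n.+1 -> \bar R) :
  measurable_fun setT f -> (forall x, 0 <= f x)%E ->
  (\int[mu n.+1]_x f x =
   \int[lebesgue_measure]_t \int[mu n]_y f (rV_cons (t, y)))%E.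
Proof.
move=> mf f0.
have mfc := measurableT_comp mf (@measurable_rV_cons R n).
rewrite -[RHS](fubini_tonelli1 _ mfc) => [|z]; last exact: f0.
have f0' : {in [set: 'rV[R]_n.+1], forall x, 0 <= f x}%E by [].
exact: (ge0_integral_pushforward (@measurable_rV_cons R n) _ measurableT mf f0').
Qed.

Lemma measurable_reflect n (a : 'rV[R]_n) :
  measurable_fun setT (fun y : 'rV[R]_n => a - y).
Proof.
apply/measurable_fun_rVP => i.
have -> : rV_coord i \o (fun y : 'rV[R]_n => a - y) =
    (fun y => a ord0 i - rV_coord i y).
  by apply/funext => y; rewrite /rV_coord /= !mxE.
apply: measurable_funB => //; exact: measurable_rV_coord.
Qed.

(** By induction on the dimension, reflecting one coordinate at a time. *)
Lemma ge0_integral_reflect n (a : 'rV[R]_n) (f : 'rV[R]_n -> \bar R) :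
  measurable_fun setT f -> (forall x, 0 <= f x)%E ->
  (\int[mu n]_y f (a - y)%R = \int[mu n]_y f y)%E.
Proof.
elim: n a f => [|n IH] a f mf f0.
  by apply: eq_integral => y _; congr f; apply/rowP => -[].
rewrite !ge0_integral_rV_cons //; last first.
  exact: measurableT_comp mf (measurable_reflect a).
pose b : 'rV[R]_n := \row_j a ord0 (lift ord0 j).
have E t y : a - rV_cons (t, y) = rV_cons (a ord0 ord0 - t, b - y).
  by apply/rowP => i; rewrite !mxE /=; case: unliftP => [j ->|->] //=; rewrite !mxE.
have mft t : measurable_fun setT (fun y : 'rV[R]_n => f (rV_cons (t, y))).
  apply: (measurableT_comp mf).
  apply: (measurableT_comp (@measurable_rV_cons R n)).
  exact: measurable_pair1.
under eq_integral => t _.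
  under eq_integral do rewrite E.
  rewrite (IH b (fun y => f (rV_cons ((a ord0 ord0 - t)%R, y)))) //.
  over.
apply: (@ge0_lebesgue_integral_reflect (a ord0 ord0)
  (fun t => \int[mu n]_y f (rV_cons (t, y)))%E).
  apply: (measurable_fun_fubini_tonelli_F (f \o @rV_cons R n)) => [|z].
    exact: measurableT_comp mf (@measurable_rV_cons R n).
  exact: f0.
by move=> t; apply: integral_ge0 => y _; exact: f0.
Qed.

Lemma integral_reflect n (a : 'rV[R]_n) (f : 'rV[R]_n -> \bar R) :
  measurable_fun setT f ->
  (\int[mu n]_y f (a - y)%R = \int[mu n]_y f y)%E.
Proof.
move=> mf; rewrite integralE [RHS]integralE; congr (_ - _)%E.
  rewrite -(@ge0_integral_reflect n a (f^\+%E)); first by rewrite funepos_comp.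
    exact: measurable_funepos.
  by move=> x; exact: funepos_ge0.
rewrite -(@ge0_integral_reflect n a (f^\-%E)); first by rewrite funeneg_comp.
  exact: measurable_funeneg.
by move=> x; exact: funeneg_ge0.
Qed.

Lemma integrable_reflect n (a : 'rV[R]_n) (f : 'rV[R]_n -> \bar R) :
  (mu n).-integrable setT f -> (mu n).-integrable setT (fun y => f (a - y)%R).
Proof.
move=> /integrableP[mf foo]; apply/integrableP; split.
  exact: measurableT_comp mf (measurable_reflect a).
have mnf := measurableT_comp (@abse_measurable R setT) mf.
have nf0 x : (0 <= (abse \o f) x)%E by exact: abse_ge0.
by rewrite (ge0_integral_reflect a mnf nf0).
Qed.

(** The substitution of [a - y] for [y] gives [f] and its reflection the same
    integral, so an upper bound on their sum controls twice the integral of [f].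
    This is how a first difference is traded for a second difference below. *)
Lemma integral_le_half_reflect n (a : 'rV[R]_n) (f h : 'rV[R]_n -> \bar R)
    (c : R) :
  (mu n).-integrable setT f -> (mu n).-integrable setT h ->
  (forall y, f y + f (a - y)%R <= h y)%E ->
  (\int[mu n]_y h y <= c%:E)%E -> (\int[mu n]_y f y <= (c / 2)%:E)%E.
Proof.
move=> inf inh fh hc.
have mf := measurable_int _ inf.
have := le_trans (le_integral measurableT
  (integrableD measurableT inf (integrable_reflect a inf)) inh
  (fun y _ => fh y)) hc.
rewrite (integralD measurableT inf (integrable_reflect a inf)).
rewrite (integral_reflect a mf).
have := integrable_fin_num measurableT inf.
by case: (\int[mu n]_y f y)%E => // t _; rewrite -EFinD !lee_fin; lra.
Qed.

End rV_measure.

(** * The kernel of the fractional Laplacian *)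

Section kernel.
Context {R : realType} (n : nat).
Implicit Types (x y h : 'rV[R]_n).
Local Notation mu := (@lebesgue_rV R n).

Lemma norm_le_enorm h : `|h| <= enorm h.
Proof.
apply/rV_norm_leP => [|i]; first exact: sqrtr_ge0.
rewrite -sqrtr_sqr ler_sqrt; last by apply: sumr_ge0 => j _; exact: sqr_ge0.
by rewrite (bigD1 i) //= lerDl; apply: sumr_ge0 => j _; exact: sqr_ge0.
Qed.

Definition sqnorm h : R := \sum_(i < n) h ord0 i ^+ 2.

Lemma sqnorm_ge0 h : 0 <= sqnorm h.
Proof. by apply: sumr_ge0 => i _; exact: sqr_ge0. Qed.

Lemma sqnorm_le h r : `|h| <= r -> sqnorm h <= n%:R * r ^+ 2.
Proof.
move=> hr; rewrite -[n in n%:R]card_ord -sumr_const mulr_suml.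
apply: ler_sum => i _; rewrite mul1r -real_normK ?num_real //.
by rewrite lerXn2r ?nnegrE ?(le_trans _ hr) // rV_coord_le_norm.
Qed.

Lemma measurable_rV_sub :
  measurable_fun setT (fun z : 'rV[R]_n * 'rV[R]_n => z.1 - z.2).
Proof.
apply/measurable_fun_rVP => i.
have -> : rV_coord i \o (fun z : 'rV[R]_n * 'rV[R]_n => z.1 - z.2) =
    (fun z => rV_coord i z.1 - rV_coord i z.2).
  by apply/funext => z; rewrite /rV_coord /= !mxE.
apply: measurable_funB.
  exact: measurableT_comp (measurable_rV_coord i) measurable_fst.
exact: measurableT_comp (measurable_rV_coord i) measurable_snd.
Qed.

Lemma measurable_rV_norm : measurable_fun setT (fun h => `|h|).
Proof. exact: continuous_measurable_rV (@norm_continuous _ _). Qed.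

Lemma measurable_enorm : measurable_fun setT (@enorm R n).
Proof.
have -> : @enorm R n = fun x => (\sum_(i < n) x ord0 i ^+ 2) `^ 2^-1.
  apply/funext => x; rewrite powR12_sqrt //.
  by apply: sumr_ge0 => j _; exact: sqr_ge0.
apply: (measurableT_comp (measurable_powR _)).
apply: measurable_sum => i; apply: measurable_funX.
exact: measurable_rV_coord.
Qed.

(** The kernel of [gagliardo_form], with the same value 0 on the diagonal. *)
Definition kern (a : R) x y : R := (enorm (x - y) `^ a)^-1.

Variable a : R.
Hypothesis a_gt0 : 0 < a.

Lemma kern_ge0 x y : 0 <= kern a x y.
Proof. by rewrite invr_ge0 powR_ge0. Qed.

Lemma enormN h : enorm (- h) = enorm h.
Proof. by congr Num.sqrt; apply: eq_bigr => i _; rewrite mxE sqrrN. Qed.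

Lemma kernC x y : kern a x y = kern a y x.
Proof. by rewrite /kern -enormN opprB. Qed.

Lemma kern_reflect x y : kern a x (x + x - y) = kern a x y.
Proof. by rewrite [RHS]kernC /kern !opprD opprK !addrA subrr add0r addrC. Qed.

Lemma kern_diag x : kern a x x = 0.
Proof.
rewrite /kern subrr (_ : enorm 0 = 0) ?powR0 ?invr0 ?gt_eqF //.
by rewrite /enorm big1 ?sqrtr0 // => i _; rewrite mxE expr0n.
Qed.

Lemma measurable_kern : measurable_fun setT (fun z => kern a z.1 z.2).
Proof.
rewrite (_ : (fun _ => _) = fun z => enorm (z.1 - z.2) `^ (- a)).
  apply: (measurableT_comp (measurable_powR _)).
  exact: measurableT_comp measurable_enorm measurable_rV_sub.
by apply/funext => z; rewrite powRN.
Qed.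

Lemma kern_le r x y : 0 < r -> r <= `|x - y| -> kern a x y <= (r `^ a)^-1.
Proof.
move=> r0 rxy; have re := le_trans rxy (norm_le_enorm (x - y)).
have e0 := lt_le_trans r0 re.
rewrite lef_pV2 ?posrE ?powR_gt0 //.
by apply: ge0_ler_powR => //; rewrite ?nnegrE ltW.
Qed.

Lemma kern_ge r x y : x != y -> `|x - y| <= r ->
  (Num.sqrt (n%:R * r ^+ 2) `^ a)^-1 <= kern a x y.
Proof.
move=> xy xyr.
have e0 : 0 < enorm (x - y).
  by rewrite (lt_le_trans _ (norm_le_enorm _))// normr_gt0 subr_eq0.
have er : enorm (x - y) <= Num.sqrt (n%:R * r ^+ 2).
  by rewrite ler_sqrt; [exact: sqnorm_le|rewrite mulr_ge0 // sqr_ge0].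
have r0 := lt_le_trans e0 er.
rewrite lef_pV2 ?posrE ?powR_gt0 //.
by apply: ge0_ler_powR => //; rewrite ?nnegrE ltW.
Qed.

End kernel.

Section dyadic.
Context {R : realType}.

Lemma dyadic_exponent (v : R) : 1 <= v -> exists j : nat, 2 ^+ j <= v < 2 ^+ j.+1.
Proof.
move=> v1.
have ex : exists m : nat, v < 2 ^+ m.
  by exists (Num.bound v); exact: upper_nthrootP.
case: (ex_minnP ex) => -[|j] vj minj; first by move: vj; rewrite ltNge v1.
exists j; rewrite vj andbT leNgt; apply/negP => /minj.
by rewrite ltnn.
Qed.

(** [f] is dominated by the sum over [j] of the functions equal to [b j] on the
    ball of radius [r j] around [x], whose integrals decay geometrically. *)
Lemma integral_dyadic_le n (x : 'rV[R]_n) (f : 'rV[R]_n -> R) (r b : nat -> R)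
    (c q : R) :
  measurable_fun setT f -> (forall y, 0 <= f y) -> 0 <= q < 1 ->
  (forall j, 0 <= r j) -> (forall j, 0 <= b j) ->
  (forall j, b j * (2 * r j) ^+ n <= c * q ^+ j) ->
  (forall y, f y = 0 \/ exists j, `|x - y| <= r j /\ f y <= b j) ->
  (\int[lebesgue_rV n]_y (f y)%:E <= (c / (1 - q))%:E)%E.
Proof.
move=> mf f0 /andP[q0 q1] r0 b0 bc fb.
pose g j y : \bar R := (b j * \1_(norm_ball x (r j)) y)%:E.
have g0 j y : (0 <= g j y)%E by rewrite lee_fin mulr_ge0.
have mg j : measurable_fun setT (g j).
  apply/measurable_EFinP/measurable_funM => //.
  exact: measurable_indic (measurable_norm_ball _ _).
have Ig j : (\int[lebesgue_rV n]_y g j y = (b j * (2 * r j) ^+ n)%:E)%E.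
  rewrite /g; under eq_integral do rewrite EFinM.
  rewrite ge0_integralZl_EFin //; last first.
    apply/measurable_EFinP; exact: measurable_indic (measurable_norm_ball _ _).
  rewrite integral_indic //; last exact: measurable_norm_ball.
  by rewrite setIT EFinM; congr (_ * _)%E; exact: lebesgue_norm_ball.
apply: (@le_trans _ _ (\int[lebesgue_rV n]_y \sum_(j <oo) g j y)%E).
  apply: ge0_le_integral => //.
  - by move=> y _; rewrite lee_fin.
  - exact/measurable_EFinP.
  - by apply: ge0_emeasurable_sum.
  - move=> y _; have [->|[j [xy fy]]] := fb y; first exact: nneseries_ge0.
    apply: (@le_trans _ _ (\sum_(0 <= i < j.+1) g i y)%E).
      rewrite big_nat_recr //= -[leLHS]add0e leeD //; first exact: sume_ge0.
      by rewrite /g indicE mem_set // mulr1 lee_fin.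
    exact: nneseries_lim_ge.
rewrite integral_nneseries //.
apply: lime_le; first by apply: is_cvg_nneseries => j _ _; exact: integral_ge0.
apply: nearW => m.
rewrite (eq_bigr (fun j => (b j * (2 * r j) ^+ n)%:E)) => [|j _]; last exact: Ig.
rewrite sumEFin lee_fin (@le_trans _ _ (\sum_(0 <= j < m) c * q ^+ j)) //.
  exact: ler_sum.
have c0 : 0 <= c.
  rewrite -[c]mulr1 -(expr0 q) (le_trans _ (bc 0)) // mulr_ge0 ?exprn_ge0 //.
  by rewrite mulr_ge0.
rewrite -mulr_sumr ler_wpM2l // big_mkord.
rewrite -[leRHS]mul1r ler_pdivlMr ?subr_gt0 //.
rewrite mulrC -[1 - q in leLHS]opprB mulNr -subrX1 opprB lerBlDl lerDr.
exact: exprn_ge0.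
Qed.

(** On dyadic shells of radius 2^-j around [x] the integral is of order
    2^(-(2 - 2s)j), and on those of radius 2^j it is of order 2^(-2sj): the first
    series converges because [s < 1], the second because [0 < s]. *)
Lemma integral_min1_kern n (s : R) : 0 < s < 1 ->
  exists2 C : R, 0 <= C & forall x : 'rV[R]_n,
  (\int[lebesgue_rV n]_y
     (Num.min 1 (`|x - y| ^+ 2) * kern (n%:R + 2 * s) x y)%:E <= C%:E)%E.
Proof.
move=> /andP[s0 s1].
set a := n%:R + 2 * s; have a0 : 0 < a.
  by rewrite ltr_wpDl // mulr_gt0.
pose p : R := 2 `^ (2 * s); pose b : R := 2 ^+ n * p.
have bE : 2 `^ a = b.
  by rewrite /a powRD ?pnatr_eq0 ?implybT // powR_mulrn.
have pow2_gt1 (r : R) : 0 < r -> 1 < 2 `^ r.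
  move=> r0; have h := @gt0_ltr_powR R r r0 1 2.
  by rewrite powR1 in h; apply: h; rewrite ?nnegrE ?ltr1n.
have p1 : 1 < p by rewrite pow2_gt1 ?mulr_gt0.
have p0 := lt_trans ltr01 p1.
have p4 : p < 4.
  rewrite [ltRHS](_ : _ = p * 2 `^ (2 * (1 - s))); last first.
    rewrite -powRD ?pnatr_eq0 ?implybT // -mulrDr addrC subrK mulr1.
    by rewrite (powR_mulrn 2) //; ring.
  by rewrite ltr_pMr ?pow2_gt1 ?mulr_gt0 ?subr_gt0 // (lt_trans _ p1).
have b0 : 0 < b by rewrite mulr_gt0 ?exprn_gt0 // (lt_trans _ p1).
have bX j : (2 ^+ j) `^ a = b ^+ j.
  by rewrite -powR_mulrn // -powRrM mulrC powRrM bE powR_mulrn // ltW.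
have min_ge0 (t : R) : 0 <= Num.min 1 (t ^+ 2) by rewrite le_min ler01 sqr_ge0.
pose f (x y : 'rV[R]_n) : R := Num.min 1 (`|x - y| ^+ 2) * kern a x y.
have f0 x y : 0 <= f x y by rewrite mulr_ge0 ?min_ge0 ?kern_ge0.
have mf x : measurable_fun setT (f x).
  have mxy : measurable_fun setT (fun y : 'rV[R]_n => x - y).
    exact: measurable_reflect.
  apply: measurable_funM.
    apply: measurable_minr => //; apply: measurable_funX.
    exact: measurableT_comp (@measurable_rV_norm R n) mxy.
  exact: (measurableT_comp (@measurable_kern R n a) (@measurable_pair1 _ _ _ _ x)).
have mB x : measurable_fun setT (\1_(norm_ball x 1) : 'rV[R]_n -> R).
  exact: measurable_indic (measurable_norm_ball x 1).
(* [q1] and [q2] are 2^(2s - 2) and 2^(-2s), the ratios of the two series. *)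
pose q1 := b / (4 * 2 ^+ n); pose c1 := b * 2 ^+ n.
pose q2 := 2 ^+ n / b; pose c2 : R := (2 * 2) ^+ n.
have q1P : 0 <= q1 < 1.
  rewrite divr_ge0 ?ltW ?mulr_gt0 ?exprn_gt0 //=.
  by rewrite ltr_pdivrMr ?mulr_gt0 ?exprn_gt0 // mul1r /b mulrC ltr_pM2r ?exprn_gt0.
have q2P : 0 <= q2 < 1.
  rewrite divr_ge0 ?ltW ?exprn_gt0 //=.
  by rewrite ltr_pdivrMr // mul1r /b ltr_pMr ?exprn_gt0.
clear bE; clearbody b.
exists (c1 / (1 - q1) + c2 / (1 - q2)).
  have [/andP[_ h1] /andP[_ h2]] := (q1P, q2P).
  have c10 : 0 <= c1 by rewrite mulr_ge0 ?exprn_ge0 // ltW.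
  have c20 : 0 <= c2 by rewrite exprn_ge0.
  by rewrite addr_ge0 // divr_ge0 // subr_ge0 ltW.
move=> x.
pose near y : R := f x y * \1_(norm_ball x 1) y.
pose far y : R := f x y * (1 - \1_(norm_ball x 1) y).
have far0 y : 0 <= far y.
  by rewrite mulr_ge0 // subr_ge0 indicE; case: (_ \in _).
have near0 y : 0 <= near y by rewrite mulr_ge0.
have mnear : measurable_fun setT near by apply: measurable_funM.
have mfar : measurable_fun setT far.
  by apply: measurable_funM => //; apply: measurable_funB.
rewrite (eq_integral (fun y => (near y)%:E + (far y)%:E)%E); last first.
  by move=> y _; rewrite -EFinD /near /far -mulrDr [1 - _]addrC addNKr mulr1.
rewrite ge0_integralD //; last 4 first.
- by move=> y _; rewrite lee_fin.
- exact/measurable_EFinP.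
- by move=> y _; rewrite lee_fin.
- exact/measurable_EFinP.
rewrite EFinD leeD //.
  apply: (@integral_dyadic_le n x near (fun j => 2^-1 ^+ j)
    (fun j => 4^-1 ^+ j * b ^+ j.+1)) => //.
  - by move=> j; rewrite mulr_ge0 ?exprn_ge0 // ltW.
  - move=> j; rewrite /c1 /q1 le_eqVlt; apply/orP; left; apply/eqP.
    rewrite invfM -exprVn !exprMn [(_ ^+ j) ^+ n]exprAC exprS.
    set u := (4^-1 ^+ j : R); set v := ((2^-1 ^+ n) ^+ j : R).
    by ring.
  - move=> y; rewrite /near indicE; have [xy|xy] := lerP `|x - y| 1; last first.
      by left; rewrite memNset ?mulr0 // /norm_ball /= leNgt xy.
    rewrite mem_set // mulr1 /f.
    have [->|xNy] := eqVneq x y; first by left; rewrite kern_diag ?mulr0.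
    right; have t0 : 0 < `|x - y| by rewrite normr_gt0 subr_eq0.
    have /dyadic_exponent[j /andP[h1 h2]] : 1 <= `|x - y|^-1.
      by rewrite invf_ge1.
    have tj : `|x - y| <= (2 ^+ j)^-1.
      by rewrite -[leLHS]invrK lef_pV2 ?posrE ?invr_gt0 ?exprn_gt0.
    have jt : (2 ^+ j.+1)^-1 <= `|x - y|.
      by rewrite -[leRHS]invrK lef_pV2 ?posrE ?invr_gt0 ?exprn_gt0 // ltW.
    exists j; split; first by rewrite exprVn.
    apply: ler_pM; [exact: min_ge0|exact: kern_ge0| |].
      rewrite ge_min; apply/orP; right.
      rewrite (_ : 4^-1 ^+ j = (2 ^+ j)^-1 ^+ 2); first by rewrite lerXn2r ?nnegrE.
      by rewrite -exprVn exprAC expr2 -invfM -natrM.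
    apply: le_trans (kern_le a0 _ jt) _; first by rewrite invr_gt0 exprn_gt0.
    by rewrite -[2 ^- _]powR_inv1 ?exprn_ge0 // -powRrM mulN1r powRN invrK bX.
apply: (@integral_dyadic_le n x far (fun j => 2 ^+ j.+1)
  (fun j => (b ^+ j)^-1)) => //.
- by move=> j; rewrite invr_ge0 exprn_ge0 // ltW.
- move=> j; rewrite /c2 /q2 le_eqVlt; apply/orP; left; apply/eqP.
  by rewrite exprS mulrA exprMn expr_div_n [(_ ^+ j) ^+ n]exprAC; ring.
- move=> y; rewrite /far indicE; have [xy|xy] := lerP `|x - y| 1.
    by left; rewrite mem_set // subrr mulr0.
  rewrite memNset; last by rewrite /norm_ball /= leNgt xy.
  rewrite subr0 mulr1 /f.
  have /dyadic_exponent[j /andP[h1 h2]] := ltW xy.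
  right; exists j; split; first exact: ltW.
  rewrite -[leRHS]mul1r; apply: ler_pM; [exact: min_ge0|exact: kern_ge0| |].
    by rewrite ge_min lexx.
  apply: le_trans (kern_le a0 _ h1) _; first by rewrite exprn_gt0.
  by rewrite bX.
Qed.

End dyadic.

(** * Truncated kernels and one-sided bounds by symmetrization *)

Section truncated.
Context {R : realType} (n : nat) (s : R).
Local Notation mu := (@lebesgue_rV R n).
Local Notation K := (@kern R n (n%:R + 2 * s)).

(** Away from the diagonal the kernel is integrable, which makes it possible to
    integrate separately the terms of a difference. *)
Definition ktrunc (rho : R) (x y : 'rV[R]_n) : R :=
  if rho <= `|x - y| then K x y else 0.

Lemma ktrunc_ge0 rho x y : 0 <= ktrunc rho x y.
Proof. by rewrite /ktrunc; case: ifP => // _; exact: kern_ge0. Qed.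

Lemma ktruncC rho x y : ktrunc rho x y = ktrunc rho y x.
Proof. by rewrite /ktrunc distrC kernC. Qed.

Lemma ktrunc_reflect rho x y : ktrunc rho x (x + x - y) = ktrunc rho x y.
Proof.
rewrite /ktrunc kern_reflect distrC (_ : x + x - y - x = x - y) //.
by rewrite addrAC addrK.
Qed.

Lemma ktrunc_le rho x y : ktrunc rho x y <= K x y.
Proof. by rewrite /ktrunc; case: ifP => // _; exact: kern_ge0. Qed.

Lemma ktrunc_le_min1 rho x y : 0 < rho <= 1 ->
  ktrunc rho x y <= (rho ^+ 2)^-1 * (Num.min 1 (`|x - y| ^+ 2) * K x y).
Proof.
move=> /andP[r0 r1]; rewrite /ktrunc; case: ifP => h.
  rewrite mulrA -[leLHS]mul1r ler_wpM2r ?kern_ge0 // mulrC.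
  rewrite ler_pdivlMr ?exprn_gt0 // mul1r le_min exprn_ile1 ?(ltW r0) //=.
  by rewrite lerXn2r ?nnegrE ?(ltW r0).
by rewrite mulr_ge0 ?invr_ge0 ?exprn_ge0 ?(ltW r0) // mulr_ge0 ?kern_ge0.
Qed.

Lemma measurable_ktrunc rho : measurable_fun setT (fun z => ktrunc rho z.1 z.2).
Proof.
apply: measurable_fun_ifT => //; last exact: measurable_kern.
apply: measurable_fun_ler => //.
exact: measurableT_comp (@measurable_rV_norm R n) (@measurable_rV_sub R n).
Qed.

Lemma measurable_ktrunc_pair rho x : measurable_fun setT (ktrunc rho x).
Proof.
exact: (measurableT_comp (measurable_ktrunc rho) (@measurable_pair1 _ _ _ _ x)).
Qed.

Variable C0 : R.
Hypothesis C0P : forall x : 'rV[R]_n,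
  (\int[mu]_y (Num.min 1 (`|x - y| ^+ 2) * K x y)%:E <= C0%:E)%E.

Let min1_ge0 (x y : 'rV[R]_n) : 0 <= Num.min 1 (`|x - y| ^+ 2) * K x y.
Proof. by rewrite mulr_ge0 ?kern_ge0 // le_min ler01 sqr_ge0. Qed.

Lemma measurable_min1_kern :
  measurable_fun setT (fun z : 'rV[R]_n * 'rV[R]_n =>
    Num.min 1 (`|z.1 - z.2| ^+ 2) * K z.1 z.2).
Proof.
apply: measurable_funM; last exact: measurable_kern.
apply: measurable_minr => //; apply: measurable_funX.
exact: measurableT_comp (@measurable_rV_norm R n) (@measurable_rV_sub R n).
Qed.

Let measurable_min1_pair x :
  measurable_fun setT (fun y : 'rV[R]_n => Num.min 1 (`|x - y| ^+ 2) * K x y).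
Proof.
exact: (measurableT_comp measurable_min1_kern (@measurable_pair1 _ _ _ _ x)).
Qed.

Lemma integral_ktrunc_le rho x : 0 < rho <= 1 ->
  (\int[mu]_y (ktrunc rho x y)%:E <= ((rho ^+ 2)^-1 * C0)%:E)%E.
Proof.
move=> r01; have r0 : 0 <= (rho ^+ 2)^-1.
  by rewrite invr_ge0 sqr_ge0.
apply: (@le_trans _ _ (\int[mu]_y ((rho ^+ 2)^-1%:E *
    (Num.min 1 (`|x - y| ^+ 2) * K x y)%:E))%E).
  apply: ge0_le_integral => //.
  - by move=> y _; rewrite lee_fin ktrunc_ge0.
  - by apply/measurable_EFinP; exact: measurable_ktrunc_pair.
  - by apply/measurable_EFinP; apply: measurable_funM.
  - by move=> y _; rewrite -EFinM lee_fin ktrunc_le_min1.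
rewrite ge0_integralZl_EFin //.
- by rewrite EFinM lee_wpmul2l.
- by move=> y _; rewrite lee_fin.
- exact/measurable_EFinP.
Qed.

Lemma integrable_ktrunc rho x : 0 < rho <= 1 ->
  mu.-integrable setT (fun y => (ktrunc rho x y)%:E).
Proof.
move=> r01; apply/integrableP; split.
  by apply/measurable_EFinP; exact: measurable_ktrunc_pair.
under eq_integral do rewrite gee0_abs ?lee_fin ?ktrunc_ge0 //.
exact: le_lt_trans (integral_ktrunc_le x r01) (ltry _).
Qed.

Lemma integrable_min1_kern x : mu.-integrable setT
  (fun y => (Num.min 1 (`|x - y| ^+ 2) * K x y)%:E).
Proof.
apply/integrableP; split; first exact/measurable_EFinP.
under eq_integral do rewrite gee0_abs ?lee_fin //.
exact: le_lt_trans (C0P x) (ltry _).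
Qed.

(** One-sided bound on a truncated fractional Laplacian: reflecting the
    integration variable through [x] replaces the first difference of [w] by half
    its second difference, so that only semiconvexity of [w] at [x] is used. *)
Lemma integral_diff_ktrunc_le (w : 'rV[R]_n -> R) (W C rho : R) x :
  measurable_fun setT w -> (forall y, `|w y| <= W) -> 0 < rho <= 1 -> 0 <= C ->
  (forall y, w x + w x - w y - w (x + x - y) <= C * Num.min 1 (`|x - y| ^+ 2)) ->
  mu.-integrable setT (fun y => ((w x - w y) * ktrunc rho x y)%:E) /\
  (\int[mu]_y ((w x - w y) * ktrunc rho x y)%:E <= (C * C0 / 2)%:E)%E.
Proof.
move=> mw wW r01 C_ge0 semi.
pose f y := ((w x - w y) * ktrunc rho x y)%:E.
have mf : measurable_fun setT f.
  apply/measurable_EFinP; apply: measurable_funM; last exact: measurable_ktrunc_pair.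
  exact: measurable_funB.
have wd y : `|w x - w y| <= 2 * W.
  by rewrite (le_trans (ler_normB _ _)) // mulr_natl mulr2n lerD.
have W0 : 0 <= W by apply: le_trans (wW x).
have inf : mu.-integrable setT f.
  apply: (@le_integrable _ _ _ _ _ _ _ (fun y => (2 * W)%:E * (ktrunc rho x y)%:E)%E) => //.
    move=> y _; rewrite -EFinM /= lee_fin !normrM (ger0_norm (ktrunc_ge0 _ _ _)).
    by rewrite ler_wpM2r ?ktrunc_ge0 // -normrM (le_trans (wd y)) ?ler_norm.
  by apply: integrableZl => //; exact: integrable_ktrunc.
split=> //.
apply: (integral_le_half_reflect (a := x + x) inf
  (integrableZl measurableT C (integrable_min1_kern x))) => [y|].
  rewrite /f ktrunc_reflect -EFinD -EFinM lee_fin -mulrDl.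
  rewrite (_ : w x - w y + (w x - w (x + x - y)) =
    w x + w x - w y - w (x + x - y)); last by ring.
  apply: (@le_trans _ _ (C * Num.min 1 (`|x - y| ^+ 2) * ktrunc rho x y)).
    by rewrite ler_wpM2r ?ktrunc_ge0.
  rewrite [leRHS]mulrA; apply: ler_wpM2l; last exact: ktrunc_le.
  by apply: mulr_ge0 => //; rewrite le_min ler01 sqr_ge0.
rewrite (integralZl measurableT (integrable_min1_kern x)).
by rewrite EFinM lee_wpmul2l ?lee_fin.
Qed.

End truncated.

(** * An upper bound for the bilinear form *)

Section energy.
Context {R : realType} (n : nat) (s : R).
Local Notation mu := (@lebesgue_rV R n).
Local Notation K := (@kern R n (n%:R + 2 * s)).
Local Notation Kt := (@ktrunc R n s).

Variable C0 : R.
Hypothesis C0P : forall x : 'rV[R]_n,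
  (\int[mu]_y (Num.min 1 (`|x - y| ^+ 2) * K x y)%:E <= C0%:E)%E.

Variables (w phi : 'rV[R]_n -> R) (A : set 'rV[R]_n) (W C eps del m v r : R).
Hypothesis mw : measurable_fun setT w.
Hypothesis wW : forall y, `|w y| <= W.
Hypothesis mphi : measurable_fun setT phi.
Hypothesis phi_ge0 : forall x, 0 <= phi x.
Hypothesis iphi : mu.-integrable setT (EFin \o phi).
Hypothesis mA : measurable A.
Hypothesis muA : mu A = v%:E.
Hypothesis eps_ge0 : 0 <= eps.
Hypothesis del_ge0 : 0 <= del.
Hypothesis C_ge0 : 0 <= C.
Hypothesis m_ge0 : 0 <= m.
Hypothesis r01 : 0 < r <= 1.
Hypothesis semi : forall x, phi x != 0 -> forall y,
  w x + w x - w y - w (x + x - y) <= C * Num.min 1 (`|x - y| ^+ 2).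
Hypothesis far : forall x y, phi x != 0 -> A y -> r <= `|x - y| /\ m <= K x y.

Let coef x y := eps * (w x - w y) - del * \1_A y.
(* After truncation the integrand of the form is at most [Psi rho x y] plus
   [Psi rho y x], and these two have the same integral. *)
Let Psi rho x y := phi x * (coef x y * Kt rho x y).
Let c := eps * (C * C0 / 2) - del * (m * v).

Let mIA : measurable_fun setT (\1_A : 'rV[R]_n -> R).
Proof. exact: measurable_indic. Qed.

Let W_ge0 : 0 <= W.
Proof. exact: le_trans (normr_ge0 _) (wW 0). Qed.

Let integral_Psi_le rho x : 0 < rho <= r ->
  (\int[mu]_y (Psi rho x y)%:E <= (c * phi x)%:E)%E.
Proof.
move=> /andP[rho0 rhor]; have rho1 : 0 < rho <= 1.
  by rewrite rho0 (le_trans rhor) //; case/andP: r01.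
have [px0|px0] := eqVneq (phi x) 0.
  rewrite px0 mulr0 integral0_eq // => y _.
  by rewrite /Psi px0 mul0r.
have [inf fle] := integral_diff_ktrunc_le C0P mw wW rho1 C_ge0 (semi px0).
pose f y := ((w x - w y) * Kt rho x y)%:E.
pose g y := (\1_A y * Kt rho x y)%:E.
have mg : measurable_fun setT g.
  by apply/measurable_EFinP/measurable_funM => //; exact: measurable_ktrunc_pair.
have ing : mu.-integrable setT g.
  apply: le_integrable (integrable_ktrunc C0P x rho1) => //.
  move=> y _; rewrite /g /= lee_fin normrM ler_piMl // indicE.
  by case: (_ \in _); rewrite ?normr1 ?normr0.
have gge : ((m * v)%:E <= \int[mu]_y g y)%E.
  apply: (@le_trans _ _ (\int[mu]_y (m%:E * (\1_A y)%:E))%E).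
    rewrite ge0_integralZl_EFin //; last exact/measurable_EFinP.
    by rewrite integral_indic // setIT EFinM lee_wpmul2l ?lee_fin // -muA.
  apply: ge0_le_integral => //.
  - by move=> y _; rewrite mule_ge0 ?lee_fin.
  - by apply: emeasurable_funM => //; exact/measurable_EFinP.
  - move=> y _; rewrite -EFinM lee_fin indicE.
    have [/set_mem Ay|_] := boolP (y \in A).
      have [h1 h2] := far px0 Ay.
      by rewrite mulr1 mul1r /ktrunc (le_trans rhor h1).
    by rewrite mulr0 mul0r.
have E : (fun y => (Psi rho x y)%:E) =
    (fun y => (phi x)%:E * (eps%:E * f y - del%:E * g y))%E.
  apply/funext => y; rewrite /f /g -!EFinM; congr EFin.
  by rewrite /Psi /coef; ring.
have i1 := integrableZl measurableT eps inf.
have i2 := integrableZl measurableT del ing.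
rewrite E integralZl //; last exact: integrableB.
rewrite integralB // !integralZl //.
rewrite -(fineK (integrable_fin_num measurableT inf)) in fle *.
rewrite -(fineK (integrable_fin_num measurableT ing)) in gge *.
rewrite -!EFinM lee_fin mulrC ler_wpM2r //.
by rewrite /c lerB // ler_wpM2l.
Qed.

Let measurable_Psi rho : measurable_fun setT (fun z => Psi rho z.1 z.2).
Proof.
apply: measurable_funM; first exact: measurableT_comp mphi measurable_fst.
apply: measurable_funM; last exact: measurable_ktrunc.
apply: measurable_funB; apply: measurable_funM => //.
  apply: measurable_funB; first exact: measurableT_comp mw measurable_fst.
  exact: measurableT_comp mw measurable_snd.
exact: measurableT_comp mIA measurable_snd.
Qed.

Let Psi_abs_fin rho : 0 < rho <= 1 ->
  (\int[mu]_x \int[mu]_y `|(Psi rho x y)%:E| < +oo)%E.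
Proof.
move=> rho1.
pose b := (eps * (2 * W) + del).
have b0 : 0 <= b by rewrite addr_ge0 ?mulr_ge0.
have cb x y : `|coef x y| <= b.
  rewrite (le_trans (ler_normB _ _)) // lerD // normrM.
    rewrite ger0_norm // ler_wpM2l // (le_trans (ler_normB _ _)) //.
    by rewrite mulr_natl mulr2n lerD.
  by rewrite ger0_norm // ger0_norm ?indicE // ler_piMr // -indicE.
have mP := measurable_Psi rho.
have mPx x : measurable_fun setT (fun y => `|(Psi rho x y)%:E|%E).
  apply: measurableT_comp => //; apply/measurable_EFinP.
  exact: (measurableT_comp mP (@measurable_pair1 _ _ _ _ x)).
apply: (@le_lt_trans _ _ (\int[mu]_x ((b * ((rho ^+ 2)^-1 * C0))%:E *
    (phi x)%:E))%E).
  apply: ge0_le_integral => //.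
  - by move=> x _; exact: integral_ge0.
  - apply: (measurable_fun_fubini_tonelli_F (fun z => `|(Psi rho z.1 z.2)%:E|%E)) => //.
    by apply: measurableT_comp => //; exact/measurable_EFinP.
  - by apply: emeasurable_funM => //; exact/measurable_EFinP.
  - move=> x _.
    apply: (@le_trans _ _ (\int[mu]_y ((b * phi x)%:E * (Kt rho x y)%:E))%E).
      apply: ge0_le_integral => //.
      + apply: emeasurable_funM => //.
        by apply/measurable_EFinP; exact: measurable_ktrunc_pair.
      + move=> y _; rewrite /Psi /= lee_fin !normrM (ger0_norm (phi_ge0 x)).
        rewrite (ger0_norm (ktrunc_ge0 _ _ _ _)) mulrA [b * _]mulrC.
        by rewrite ler_wpM2r ?ktrunc_ge0 // ler_wpM2l.
    rewrite ge0_integralZl_EFin ?mulr_ge0 //.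
    + apply: le_trans (lee_wpmul2l _ (integral_ktrunc_le C0P x rho1)) _.
        by rewrite lee_fin mulr_ge0.
      by rewrite -!EFinM lee_fin mulrAC.
    + by move=> y _; rewrite lee_fin ktrunc_ge0.
    + by apply/measurable_EFinP; exact: measurable_ktrunc_pair.
rewrite integralZl //.
by rewrite -(fineK (integrable_fin_num measurableT iphi)) -EFinM ltry.
Qed.

Let integral_Psi_prod_le rho : 0 < rho <= r ->
  [/\ (mu \x mu)%E.-integrable setT (fun z => (Psi rho z.1 z.2)%:E),
   (mu \x mu)%E.-integrable setT (fun z => (Psi rho z.2 z.1)%:E),
   (\int[mu \x mu]_z (Psi rho z.1 z.2)%:E <= c%:E * \int[mu]_x (phi x)%:E)%E &
   (\int[mu \x mu]_z (Psi rho z.2 z.1)%:E <= c%:E * \int[mu]_x (phi x)%:E)%E].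
Proof.
move=> rhor; have rho1 : 0 < rho <= 1.
  case/andP: r01 rhor => _ r1 /andP[-> h]; exact: le_trans r1.
have mP : measurable_fun setT (fun z => (Psi rho z.1 z.2)%:E).
  apply/measurable_EFinP; exact: measurable_Psi.
have mP' : measurable_fun setT (fun z => (Psi rho z.2 z.1)%:E).
  exact: (measurableT_comp mP (@measurable_swap _ _ 'rV[R]_n 'rV[R]_n)).
have i1 : (mu \x mu)%E.-integrable setT (fun z => (Psi rho z.1 z.2)%:E).
  by apply/(integrable12ltyP _ _ mP); exact: Psi_abs_fin.
have i2 : (mu \x mu)%E.-integrable setT (fun z => (Psi rho z.2 z.1)%:E).
  by apply/(integrable21ltyP _ _ mP'); exact: Psi_abs_fin.
have le : (\int[mu]_x \int[mu]_y (Psi rho x y)%:E <=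
    c%:E * \int[mu]_x (phi x)%:E)%E.
  rewrite -integralZl //; apply: le_integral => //.
  - exact: (integrable_fubini_F i1).
  - exact: integrableZl.
  - by move=> x _; rewrite -EFinM; exact: integral_Psi_le.
split=> //; first by rewrite -(integral12_prod_meas1 i1).
by rewrite -(integral21_prod_meas1 i2).
Qed.

(** Comparison of the form with a multiple of the integral of [phi].  The last
    hypothesis bounds the integrand by two terms exchanged by the swap of [x] and
    [y]; each is [phi] times a difference of [eps * w], handled by semiconvexity of
    [w], minus the mass that [phi] sees on the distant set [A].  The separate terms
    need not be integrable against the kernel itself, so the bound is proved for the
    kernels truncated at distance r/(j+1), and dominated convergence removes the
    truncation. *)
Lemma gagliardo_form_le (u : 'rV[R]_n -> R) :
  measurable_fun setT u ->
  (mu \x mu)%E.-integrable setT (fun z =>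
     ((u z.1 - u z.2) * (phi z.1 - phi z.2) * K z.1 z.2)%:E) ->
  (forall x y, (u x - u y) * (phi x - phi y) <=
     phi x * (eps * (w x - w y) - del * \1_A y) +
     phi y * (eps * (w y - w x) - del * \1_A x)) ->
  (gagliardo_form s u phi <= (2 * c)%:E * \int[mu]_x (phi x)%:E)%E.
Proof.
move=> mmu iG ptw.
pose G z := ((u z.1 - u z.2) * (phi z.1 - phi z.2) * K z.1 z.2)%:E.
pose G_ (j : nat) z :=
  ((u z.1 - u z.2) * (phi z.1 - phi z.2) * Kt (r / j.+1%:R) z.1 z.2)%:E.
have [r0 r1] := andP r01.
have rho_j j : 0 < r / j.+1%:R <= r.
  by rewrite divr_gt0 // ler_piMr ?(ltW r0) // invf_le1 // ler1n.
have mG_ j : measurable_fun setT (G_ j).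
  apply/measurable_EFinP; apply: measurable_funM; last exact: measurable_ktrunc.
  apply: measurable_funM; apply: measurable_funB.
  - exact: measurableT_comp mmu measurable_fst.
  - exact: measurableT_comp mmu measurable_snd.
  - exact: measurableT_comp mphi measurable_fst.
  - exact: measurableT_comp mphi measurable_snd.
have G_G j z : (`|G_ j z| <= `|G z|)%E.
  rewrite /G_ /G lee_fin !normrM ler_wpM2l ?mulr_ge0 //.
  by rewrite !ger0_norm ?ktrunc_ge0 ?kern_ge0 // ktrunc_le.
have iG_ j : (mu \x mu)%E.-integrable setT (G_ j).
  by apply: (le_integrable measurableT (mG_ j) _ iG) => z _; exact: G_G.
have G_le j : (\int[mu \x mu]_z G_ j z <= (2 * c)%:E * \int[mu]_x (phi x)%:E)%E.
  have [i1 i2 l1 l2] := integral_Psi_prod_le (rho_j j).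
  have -> : ((2 * c)%:E * \int[mu]_x (phi x)%:E =
     c%:E * \int[mu]_x (phi x)%:E + c%:E * \int[mu]_x (phi x)%:E)%E.
    rewrite -(fineK (integrable_fin_num measurableT iphi)) -!EFinM -EFinD.
    by congr EFin; ring.
  apply: (le_trans _ (leeD l1 l2)).
  rewrite -(integralD measurableT i1 i2).
  apply: (le_integral measurableT (iG_ j) (integrableD measurableT i1 i2)) => z _.
  rewrite -EFinD lee_fin /Psi [Kt _ z.2 z.1]ktruncC.
  by rewrite !mulrA -mulrDl ler_wpM2r ?ktrunc_ge0.
have [_ _ cv] : [/\ (mu \x mu)%E.-integrable setT G,
    [sequence \int[mu \x mu]_z `|G_ j z - G z|]_j @ \oo --> 0 &
    [sequence \int[mu \x mu]_z G_ j z]_j @ \oo --> \int[mu \x mu]_z G z]%E.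
  apply: (@dominated_convergence _ _ _ _ _ measurableT G_ G (fun z => `|G z|)%E) => //.
  - by case/integrableP: iG.
  - apply: aeW => z _.
    apply: cvg_near_cst.
    have [zz|zz] := eqVneq z.1 z.2.
      apply: nearW => j; rewrite /G_ /G zz ?subrr ?mul0r //.
    have t0 : 0 < `|z.1 - z.2| by rewrite normr_gt0 subr_eq0.
    have d0 : 0 < `|z.1 - z.2| / r by rewrite divr_gt0.
    near=> j; rewrite /G_ /G /ktrunc ifT // mulrC -ler_pdivlMr //.
    near: j; apply: filterS (near_infty_natSinv_lt (PosNum d0)) => j /= /ltW.
    by [].
  - exact: integrable_abse.
  - by apply: aeW => z j _; exact: G_G.
have -> : gagliardo_form s u phi = (\int[mu \x mu]_z G z)%E by [].
rewrite -(cvg_lim _ cv) //; apply: lime_le; first by apply/cvg_ex; eexists; exact: cv.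
exact: nearW.
Unshelve. all: end_near. Qed.

End energy.

(** * A truncated paraboloid *)

Section positive_part.
Context {R : realType}.
Implicit Types p q : R.

Lemma max0_neq0 p : Num.max 0 p != 0 -> Num.max 0 p = p.
Proof. by rewrite maxC /Num.max; case: ifP => // _ /eqP. Qed.

Lemma ler_dist_max0 p q : `|Num.max 0 p - Num.max 0 q| <= `|p - q|.
Proof.
rewrite ler_norml; have := ler_norm (p - q); have := lerNnormlW (lexx `|p - q|).
by case: (leP 0 p) => ?; case: (leP 0 q) => ? ? ?; apply/andP; split; lra.
Qed.

End positive_part.

Section bump.
Context {R : realType} (n : nat) (x0 : 'rV[R]_n) (r : R).
Implicit Types x y h : 'rV[R]_n.
Hypothesis r_ge0 : 0 <= r.

(** The paraboloid is cut off by a maximum instead of a smooth bump: semiconvexity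
    on the set where it is positive and Lipschitz continuity are all that the
    argument asks of it, and both are elementary for this function. *)
Definition bump x : R := Num.max 0 (r ^+ 2 - sqnorm (x - x0)).

Lemma bump_ge0 x : 0 <= bump x.
Proof. by rewrite le_max lexx. Qed.

Lemma bump_le x : bump x <= r ^+ 2.
Proof. by rewrite ge_max sqr_ge0 gerBl sqnorm_ge0. Qed.

Lemma bump_ge x : r ^+ 2 - sqnorm (x - x0) <= bump x.
Proof. by rewrite le_max lexx orbT. Qed.

Lemma bump_neq0 x : bump x != 0 -> bump x = r ^+ 2 - sqnorm (x - x0).
Proof. exact: max0_neq0. Qed.

Lemma bump_supp x : bump x != 0 -> norm_ball x0 r x.
Proof.
move=> bx; have : 0 < bump x by rewrite lt_def bx bump_ge0.
rewrite bump_neq0 // subr_gt0 => /ltW h.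
rewrite /norm_ball /= distrC; apply: le_trans (norm_le_enorm _) _.
by rewrite -[leRHS]ger0_norm // -sqrtr_sqr ler_wsqrtr.
Qed.

Lemma measurable_bump : measurable_fun setT bump.
Proof.
apply: measurable_maxr => //; apply: measurable_funB => //.
apply: measurable_sum => i; apply: measurable_funX.
have -> : (fun x => (x - x0) ord0 i) = (fun x => rV_coord i x - x0 ord0 i).
  by apply/funext => x; rewrite /rV_coord !mxE.
apply: measurable_funB => //; exact: measurable_rV_coord.
Qed.

(** At a point where it is positive, [bump] equals a paraboloid lying below it
    everywhere, and the second difference of the paraboloid is constant in [x] by
    the parallelogram identity. *)
Lemma bump_semiconvex x y : bump x != 0 ->
  bump x + bump x - bump y - bump (x + x - y) <=
  (2 * n%:R + 2 * r ^+ 2) * Num.min 1 (`|x - y| ^+ 2).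
Proof.
move=> bx; set t := `|x - y|.
have par : sqnorm (y - x0) + sqnorm (x + x - y - x0) =
    2 * sqnorm (x - x0) + 2 * sqnorm (x - y).
  rewrite /sqnorm !mulr_sumr -!big_split /=; apply: eq_bigr => i _.
  by rewrite !mxE; ring.
have h1 : bump x + bump x - bump y - bump (x + x - y) <= 2 * n%:R * t ^+ 2.
  have := bump_ge y; have := bump_ge (x + x - y).
  have := sqnorm_le (lexx t); rewrite -/(sqnorm _) (bump_neq0 bx).
  by move: par; lra.
have h2 : bump x + bump x - bump y - bump (x + x - y) <= 2 * r ^+ 2.
  by have := bump_le x; have := bump_ge0 y; have := bump_ge0 (x + x - y); lra.
have t0 : 0 <= t ^+ 2 by exact: sqr_ge0.
have n0 : 0 <= n%:R :> R by [].
have r0 : 0 <= r ^+ 2 by exact: sqr_ge0.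
case: (leP 1 (t ^+ 2)) => _; first by rewrite mulr1; lra.
apply: le_trans h1 _.
by rewrite ler_wpM2r // lerDl mulr_ge0.
Qed.

(** For [y] close to [x] the bound comes from factoring a difference of squares
    coordinatewise, for distant [y] from boundedness. *)
Lemma bump_lipschitz x y : norm_ball x0 r x ->
  (bump x - bump y) ^+ 2 <=
  ((n%:R * (2 * r + 1)) ^+ 2 + r ^+ 2 ^+ 2) * Num.min 1 (`|x - y| ^+ 2).
Proof.
move=> Bx; set t := `|x - y|; set L := n%:R * (2 * r + 1).
have t0 : 0 <= t by exact: normr_ge0.
have h2 : (bump x - bump y) ^+ 2 <= r ^+ 2 ^+ 2.
  rewrite -real_normK ?num_real // lerXn2r ?nnegrE ?sqr_ge0 // ler_norml.
  have := bump_le x; have := bump_le y; have := bump_ge0 x; have := bump_ge0 y.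
  by move=> *; apply/andP; split; lra.
have L0 : 0 <= L ^+ 2 by exact: sqr_ge0.
have [t1|t1] := leP 1 t.
  have -> : Num.min 1 (t ^+ 2) = 1 by apply/min_idPl; rewrite exprn_ege1.
  by rewrite mulr1 (le_trans h2) // lerDr.
have -> : Num.min 1 (t ^+ 2) = t ^+ 2.
  by apply/min_idPr; rewrite exprn_ile1 // ltW.
rewrite mulrDl (@le_trans _ _ (L ^+ 2 * t ^+ 2)) ?lerDl ?mulr_ge0 ?sqr_ge0 //.
rewrite -exprMn -real_normK ?num_real // lerXn2r ?nnegrE ?mulr_ge0 ?addr_ge0 //.
  by rewrite mulr_ge0.
apply: le_trans (ler_dist_max0 _ _) _.
rewrite (_ : r ^+ 2 - sqnorm (x - x0) - (r ^+ 2 - sqnorm (y - x0)) =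
  \sum_(i < n) (y - x) ord0 i * (x + y - x0 - x0) ord0 i); last first.
  transitivity (sqnorm (y - x0) - sqnorm (x - x0)); first by ring.
  rewrite -sumrB; apply: eq_bigr => i _.
  by rewrite !mxE; ring.
apply: le_trans (ler_norm_sum _ _ _) _.
rewrite /L mulrAC -mulrA -[n in n%:R]card_ord -sumr_const mulr_suml.
apply: ler_sum => i _; rewrite mul1r normrM.
apply: ler_pM => //.
  by rewrite /t distrC rV_coord_le_norm.
apply: le_trans (rV_coord_le_norm _ _) _.
have -> : x + y - x0 - x0 = (x - x0) + (x - x0) - (x - y).
  by apply/rowP => j; rewrite !mxE; ring.
apply: le_trans (ler_normB _ _) _; apply: lerD; last exact: ltW.
apply: le_trans (ler_normD _ _) _.
by rewrite mulr_natl mulr2n lerD // distrC.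
Qed.

Lemma bump_energy_le x y :
  (bump x - bump y) ^+ 2 <=
  ((n%:R * (2 * r + 1)) ^+ 2 + r ^+ 2 ^+ 2) *
  (Num.min 1 (`|x - y| ^+ 2) * (\1_(norm_ball x0 r) x + \1_(norm_ball x0 r) y)).
Proof.
set L := (n%:R * (2 * r + 1)) ^+ 2 + r ^+ 2 ^+ 2; have L0 : 0 <= L by rewrite addr_ge0 // sqr_ge0.
have m0 : 0 <= Num.min 1 (`|x - y| ^+ 2) by rewrite le_min ler01 sqr_ge0.
have [Bx|Bx] := pselect (norm_ball x0 r x).
  apply: le_trans (bump_lipschitz y Bx) _.
  apply: ler_wpM2l => //; rewrite ler_peMr // [\1__ x]indicE mem_set //.
  by rewrite lerDl.
have [By|By] := pselect (norm_ball x0 r y).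
  rewrite -[_ - _]opprB sqrrN distrC; apply: le_trans (bump_lipschitz x By) _.
  apply: ler_wpM2l => //; rewrite distrC ler_peMr // [\1__ y]indicE mem_set //.
  by rewrite lerDr.
have -> : bump x = 0 by apply/eqP/negPn/negP => /bump_supp.
have -> : bump y = 0 by apply/eqP/negPn/negP => /bump_supp.
by rewrite subrr expr0n /= mulr_ge0 // mulr_ge0 // addr_ge0.
Qed.

End bump.

(** * Functions of finite energy *)

Section energy_space.
Context {R : realType} (n : nat) (s : R).
Local Notation mu := (@lebesgue_rV R n).
Local Notation K := (@kern R n (n%:R + 2 * s)).
Implicit Types f g h : 'rV[R]_n -> R.

Definition energy f : \bar R :=
  (\int[mu \x mu]_z ((f z.1 - f z.2) ^+ 2 * K z.1 z.2)%:E)%E.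

Lemma homogeneous_sobolev_energy f :
  homogeneous_sobolev s f -> (energy f < +oo)%E.
Proof.
case=> _; congr (_ < _)%E; apply: eq_integral => z _.
by rewrite real_normK ?num_real.
Qed.

Lemma measurable_diff f : measurable_fun setT f ->
  measurable_fun setT (fun z : 'rV[R]_n * 'rV[R]_n => f z.1 - f z.2).
Proof.
move=> mf; apply: measurable_funB.
  exact: measurableT_comp mf measurable_fst.
exact: measurableT_comp mf measurable_snd.
Qed.

Lemma measurable_energy f : measurable_fun setT f ->
  measurable_fun setT (fun z => ((f z.1 - f z.2) ^+ 2 * K z.1 z.2)%:E).
Proof.
move=> mf; apply/measurable_EFinP; apply: measurable_funM.
  by apply: measurable_funX; exact: measurable_diff.
exact: measurable_kern.
Qed.

Let sqK_ge0 f z : 0 <= (f z.1 - f z.2) ^+ 2 * K z.1 z.2.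
Proof. by rewrite mulr_ge0 ?sqr_ge0 ?kern_ge0. Qed.

Lemma integrable_energy f : measurable_fun setT f -> (energy f < +oo)%E ->
  (mu \x mu)%E.-integrable setT
    (fun z => ((f z.1 - f z.2) ^+ 2 * K z.1 z.2)%:E).
Proof.
move=> mf foo; apply/integrableP; split; first exact: measurable_energy.
by under eq_integral do rewrite gee0_abs ?lee_fin ?sqK_ge0 //.
Qed.

(** Cauchy-Schwarz in the form |pq| <= p^2 + q^2. *)
Lemma integrable_gagliardo f g :
  measurable_fun setT f -> measurable_fun setT g ->
  (energy f < +oo)%E -> (energy g < +oo)%E ->
  (mu \x mu)%E.-integrable setT
    (fun z => ((f z.1 - f z.2) * (g z.1 - g z.2) * K z.1 z.2)%:E).
Proof.
move=> mf mg foo goo.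
have ifg := integrableD measurableT (integrable_energy mf foo)
  (integrable_energy mg goo).
apply: (le_integrable measurableT _ _ ifg) => [|z _].
  apply/measurable_EFinP; apply: measurable_funM; last exact: measurable_kern.
  by apply: measurable_funM; exact: measurable_diff.
rewrite -EFinD /= lee_fin [leRHS]ger0_norm ?addr_ge0 // -mulrDl.
rewrite normrM (ger0_norm (kern_ge0 _ _ _)) ler_wpM2r ?kern_ge0 //.
move: (f z.1 - _) (g z.1 - _) => p q.
by rewrite ler_norml; apply/andP; split; nra.
Qed.

Lemma energy_lin_le f g h (a b : R) :
  measurable_fun setT f -> measurable_fun setT g -> measurable_fun setT h ->
  (energy f < +oo)%E -> (energy g < +oo)%E ->
  (forall x y, (h x - h y) ^+ 2 <= a * (f x - f y) ^+ 2 + b * (g x - g y) ^+ 2) ->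
  (energy h < +oo)%E.
Proof.
move=> mf mg mh foo goo hfg.
have ifg := integrableD measurableT
  (integrableZl measurableT a (integrable_energy mf foo))
  (integrableZl measurableT b (integrable_energy mg goo)).
have : (mu \x mu)%E.-integrable setT
    (fun z => ((h z.1 - h z.2) ^+ 2 * K z.1 z.2)%:E).
  apply: (le_integrable measurableT (measurable_energy mh) _ ifg) => z _.
  rewrite -!EFinM -EFinD /= lee_fin (ger0_norm (sqK_ge0 _ _)).
  apply: (le_trans _ (ler_norm _)).
  rewrite [X in _ <= X + _]mulrA [X in _ <= _ + X]mulrA -mulrDl.
  apply: ler_wpM2r; [exact: kern_ge0|exact: hfg].
move=> /integrableP[_]; congr (_ < _)%E; apply: eq_integral => z _.
by rewrite gee0_abs ?lee_fin.
Qed.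

Lemma bounded_supp_integrable f (B : set 'rV[R]_n) (M : R) :
  measurable_fun setT f -> measurable B -> (mu B < +oo)%E ->
  (forall x, `|f x| <= M * \1_B x) -> mu.-integrable setT (EFin \o f).
Proof.
move=> mf mB Boo fM; apply/integrableP; split; first exact/measurable_EFinP.
have mIB : measurable_fun setT (fun x => (\1_B x)%:E : \bar R).
  by apply/measurable_EFinP; exact: measurable_indic.
apply: (@le_lt_trans _ _ (\int[mu]_x (`|M|%:E * (\1_B x)%:E))%E).
  apply: ge0_le_integral => //.
  - by apply: measurableT_comp => //; exact/measurable_EFinP.
  - exact: emeasurable_funM.
  - move=> x _; rewrite /= lee_fin; apply: le_trans (fM x) _.
    by rewrite ler_wpM2r // ler_norm.
rewrite ge0_integralZl_EFin // integral_indic // setIT.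
by rewrite lte_mul_pinfty ?lee_fin.
Qed.

Lemma bounded_supp_in_Lp f (B : set 'rV[R]_n) (M p : R) :
  measurable_fun setT f -> measurable B -> (mu B < +oo)%E -> 0 < p ->
  (forall x, `|f x| <= M * \1_B x) -> in_Lp p%:E f.
Proof.
move=> mf mB Boo p0 fM; exists f; last exact: aeW.
rewrite inE; apply/andP; split; rewrite inE //=.
rewrite /finite_norm unlock; apply: poweR_lty.
have mfp : measurable_fun setT (fun x => `|f x| `^ p).
  apply: (measurableT_comp (measurable_powR p)); exact: measurableT_comp.
have fp x : `| `|f x| `^ p| <= `|M| `^ p * \1_B x.
  rewrite ger0_norm ?powR_ge0 //; have := fM x; rewrite indicE.
  case: (x \in B) => /=; rewrite ?mulr1 ?mulr0 => fx.
    apply: ge0_ler_powR; rewrite ?nnegrE ?(ltW p0) //.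
    exact: le_trans fx (ler_norm _).
  have -> : `|f x| = 0 by apply/eqP; rewrite eq_le fx normr_ge0.
  by rewrite powR0 ?gt_eqF.
have /integrableP[_] := bounded_supp_integrable mfp mB Boo fp.
congr (_ < _)%E; apply: eq_integral => x _ /=.
by rewrite ger0_norm ?powR_ge0.
Qed.

(** By [bump_energy_le] the energy density is dominated by min(1, t^2) times the
    kernel, restricted to pairs with a point in the ball; Tonelli's theorem is used
    in one order for the first point and in the other for the second. *)
Lemma bump_energy (x0 : 'rV[R]_n) r : 0 < s < 1 -> 0 <= r ->
  (energy (bump x0 r) < +oo)%E.
Proof.
move=> s01 r0; have [C0 C00 C0P] := integral_min1_kern n s01.
pose B := norm_ball x0 r.
pose h (z : 'rV[R]_n * 'rV[R]_n) := Num.min 1 (`|z.1 - z.2| ^+ 2) * K z.1 z.2.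
have h0 z : 0 <= h z by rewrite mulr_ge0 ?kern_ge0.
have mh : measurable_fun setT h by exact: measurable_min1_kern.
have mB : measurable_fun setT (\1_B : 'rV[R]_n -> R).
  exact: measurable_indic (measurable_norm_ball x0 r).
pose h1 z := (h z * \1_B z.1)%:E; pose h2 z := (h z * \1_B z.2)%:E.
have mh1 : measurable_fun setT h1.
  apply/measurable_EFinP; apply: measurable_funM => //.
  exact: measurableT_comp mB measurable_fst.
have mh2 : measurable_fun setT h2.
  apply/measurable_EFinP; apply: measurable_funM => //.
  exact: measurableT_comp mB measurable_snd.
have h10 z : (0 <= h1 z)%E by rewrite lee_fin mulr_ge0.
have h20 z : (0 <= h2 z)%E by rewrite lee_fin mulr_ge0.
have IB : (\int[mu]_x (C0%:E * (\1_B x)%:E) < +oo)%E.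
  rewrite ge0_integralZl_EFin //; last exact/measurable_EFinP.
  rewrite integral_indic //; last exact: measurable_norm_ball.
  rewrite setIT lte_mul_pinfty ?lee_fin //.
  by rewrite [X in (X < _)%E](lebesgue_norm_ball x0 r0) ltry.
have inner x : (\int[mu]_y (h (x, y) * \1_B x)%:E <= C0%:E * (\1_B x)%:E)%E.
  under eq_integral do rewrite EFinM muleC.
  rewrite ge0_integralZl_EFin //.
  - by rewrite muleC lee_wpmul2r ?lee_fin //; exact: C0P.
  - by move=> y _; rewrite lee_fin.
  - apply/measurable_EFinP.
    exact: (measurableT_comp mh (@measurable_pair1 _ _ _ _ x)).
have h1oo : (\int[mu \x mu]_z h1 z < +oo)%E.
  rewrite (fubini_tonelli1 _ mh1 h10); apply: le_lt_trans IB.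
  apply: ge0_le_integral => //.
  - by move=> x _; exact: integral_ge0.
  - exact: measurable_fun_fubini_tonelli_F.
  - by apply: emeasurable_funM => //; exact/measurable_EFinP.
  - by move=> x _; exact: inner.
have h2oo : (\int[mu \x mu]_z h2 z < +oo)%E.
  rewrite (fubini_tonelli2 _ mh2 h20); apply: le_lt_trans IB.
  apply: ge0_le_integral => //.
  - by move=> x _; exact: integral_ge0.
  - exact: measurable_fun_fubini_tonelli_G.
  - by apply: emeasurable_funM => //; exact/measurable_EFinP.
  - move=> y _; apply: le_trans (inner y).
    rewrite le_eqVlt; apply/orP; left; apply/eqP; apply: eq_integral => x _.
    by rewrite /h2 /h /= distrC kernC.
set L := (n%:R * (2 * r + 1)) ^+ 2 + r ^+ 2 ^+ 2.
have L0 : 0 <= L by rewrite addr_ge0 // sqr_ge0.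
apply: (@le_lt_trans _ _ (\int[mu \x mu]_z (L%:E * (h1 z + h2 z)))%E).
  apply: ge0_le_integral => //.
  - by move=> z _; rewrite lee_fin.
  - by apply: measurable_energy; exact: measurable_bump.
  - by apply: emeasurable_funM => //; exact: emeasurable_funD.
  - move=> z _; rewrite /h1 /h2 -EFinD -EFinM lee_fin /h -mulrDr.
    apply: le_trans (ler_wpM2r (kern_ge0 _ _ _) (bump_energy_le x0 r0 _ _)) _.
    by rewrite le_eqVlt; apply/orP; left; apply/eqP; rewrite -/L /B; ring.
rewrite ge0_integralZl_EFin //.
- rewrite lte_mul_pinfty ?lee_fin // ge0_integralD // lte_add_pinfty //.
- by move=> z _; rewrite adde_ge0.
- exact: emeasurable_funD.
Qed.

Import HBNNSimple.

(** Even for a nonmeasurable [f], the integral of the positive part is a supremum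
    over the simple functions below it; these are measurable and lie almost
    everywhere below [g], so monotonicity applies to each of them. *)
Lemma integral_ae_le f g : measurable_fun setT g -> (forall x, 0 <= g x) ->
  (\forall x \ae mu, f x <= g x) ->
  (\int[mu]_x (f x)%:E <= \int[mu]_x (g x)%:E)%E.
Proof.
move=> mg g0 fg; rewrite integralE.
apply: (@le_trans _ _ (\int[mu]_x (EFin \o f)^\+ x)%E).
  by rewrite -[leRHS]sube0 leeB // integral_ge0.
rewrite ge0_integralTE //; apply: ge_ereal_sup => _ [h hf <-].
have -> : sintegral mu h = (\int[mu]_x (h x)%:E)%E.
  by rewrite integral_nnsfun // patch_setT.
apply: ae_ge0_le_integral => //.
- by move=> x _; rewrite lee_fin; exact: fun_ge0.
- exact/measurable_EFinP.
- by move=> x _; rewrite lee_fin.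
- exact/measurable_EFinP.
apply: filterS fg => x fgx _; apply: le_trans (hf x) _.
by rewrite funeposE ge_max lee_fin fgx lee_fin /=.
Qed.

End energy_space.

(** * The test function *)

Section test_function.
Context {R : realType} (n : nat).
Local Notation mu := (@lebesgue_rV R n).

Lemma compact_norm_ball (x : 'rV[R]_n) r : 0 <= r -> compact (norm_ball x r).
Proof.
move=> r0; rewrite norm_ball_box //.
apply: (@rV_compact _ _ (fun i => `[x ord0 i - r, x ord0 i + r]%classic)) => i.
exact: segment_compact.
Qed.

Lemma Linfty_loc_bound (c : 'rV[R]_n -> R) (B : set 'rV[R]_n) :
  in_Linfty_loc c -> compact B ->
  exists2 M : R, 0 <= M & \forall x \ae mu, B x -> `|c x| <= M.
Proof.
move=> cinf cB; have [g gL cg] := cinf _ cB.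
have muT : (0 < mu [set: 'rV[R]_n])%E.
  apply: (@lt_le_trans _ _ (mu (norm_ball 0 1))).
    by rewrite [ltRHS]lebesgue_norm_ball // lte_fin exprn_gt0 // mulr_gt0.
  by apply: le_measure; rewrite ?inE //; exact: measurable_norm_ball.
have : (ess_sup mu (abse \o (EFin \o g)) < +oo)%E.
  have := set_mem (sub_Lfun_finLfun gL).
  by rewrite /= /finite_norm unlock muT.
set S := ess_sup _ _ => Soo.
have [M M0 SM] : exists2 M : R, 0 <= M & (S <= M%:E)%E.
  case: S Soo => [t _|//|_]; last by exists 0; rewrite ?leNye.
  by exists `|t|; rewrite ?lee_fin ?ler_norm.
have gS : \forall x \ae mu, ((abse \o (EFin \o g)) x <= S)%E.
  exact: ess_sup_ge.
exists M => //; apply: filterS2 gS cg => x gS cg Bx.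
have {}cg := cg I; rewrite /= indicE mem_set // mulr1 in cg.
by rewrite cg -lee_fin; exact: le_trans gS SM.
Qed.

Lemma continuous_lower_bound (u : 'rV[R]_n -> R) x (t : R) :
  continuous u -> t < u x ->
  exists2 r : R, 0 < r & forall y, norm_ball x r y -> t <= u y.
Proof.
move=> cu tu; have near_x : \forall y \near x, t < u y.
  exact: (cvgr_gt (u x) (cu x) _ tu).
have [e e0 he] := (nbhs_normP x _).1 near_x.
exists (e / 2); first by rewrite divr_gt0.
move=> y xy; apply/ltW/he; rewrite /ball_ /=.
by apply: le_lt_trans xy _; rewrite ltr_pdivrMr // ltr_pMr // ltr1n.
Qed.

End test_function.

Section excess.
Context {R : realType} (n : nat) (s : R) (u : 'rV[R]_n -> R) (x0 : 'rV[R]_n).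
Variables r eps : R.
Hypothesis s01 : 0 < s < 1.
Hypothesis n_gt2s : 2 * s < n%:R.
Hypothesis u_Hs : homogeneous_sobolev s u.
Hypothesis u_cont : continuous u.
Hypothesis u_ge0 : forall x, 0 <= u x.
Hypothesis r_gt0 : 0 < r.
Hypothesis eps_gt0 : 0 < eps.
Local Notation mu := (@lebesgue_rV R n).
Local Notation B := (norm_ball x0 r).

(** The part of the small bump that sticks out above [u].  It lives where [u] is
    below [eps * r ^+ 2], and is nonzero as soon as [u] vanishes at [x0]. *)
Definition excess x : R := Num.max 0 (eps * bump x0 r x - u x).

Lemma excess_ge0 x : 0 <= excess x.
Proof. by rewrite le_max lexx. Qed.

Lemma excess_ge x : eps * bump x0 r x - u x <= excess x.
Proof. by rewrite le_max lexx orbT. Qed.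

Lemma excess_neq0 x : excess x != 0 -> excess x = eps * bump x0 r x - u x.
Proof. exact: max0_neq0. Qed.

Lemma bump_excess_neq0 x : excess x != 0 -> bump x0 r x != 0.
Proof.
move=> ex; apply: contraTneq (excess_ge0 x) => bx.
rewrite excess_neq0 // bx mulr0 sub0r oppr_ge0 -ltNge lt_def u_ge0 andbT.
apply: contra ex => /eqP ux.
by rewrite /excess bx mulr0 ux subrr maxxx.
Qed.

Lemma excess_supp x : excess x != 0 -> B x.
Proof. by move=> /bump_excess_neq0; apply: bump_supp; exact: ltW. Qed.

Let er_gt0 : 0 < eps * r ^+ 2.
Proof. by rewrite mulr_gt0 // exprn_gt0. Qed.

Let eps_bump_le x : eps * bump x0 r x <= eps * r ^+ 2.
Proof. by rewrite ler_wpM2l ?bump_le // ltW. Qed.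

Lemma excess_le x : excess x <= eps * r ^+ 2 * \1_B x.
Proof.
have [->|ex] := eqVneq (excess x) 0; first by rewrite mulr_ge0 // ltW.
rewrite indicE mem_set ?mulr1; last exact: excess_supp.
by rewrite excess_neq0 // lerBlDr (le_trans (eps_bump_le x)) // lerDl.
Qed.

Lemma le_excess_neq0 x : excess x != 0 -> u x <= eps * r ^+ 2.
Proof.
move=> ex; have := excess_ge0 x; rewrite excess_neq0 // subr_ge0 => h.
exact: le_trans h (eps_bump_le x).
Qed.

Lemma measurable_excess : measurable_fun setT excess.
Proof.
apply: measurable_maxr => //; apply: measurable_funB.
  by apply: measurable_funM => //; exact: measurable_bump.
exact: continuous_measurable_rV.
Qed.

Let B_fin : (mu B < +oo)%E.
Proof. by rewrite [ltLHS](lebesgue_norm_ball x0 (ltW r_gt0)) ltry. Qed.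

Let normr_excess_le x : `|excess x| <= eps * r ^+ 2 * \1_B x.
Proof. by rewrite ger0_norm ?excess_ge0 // excess_le. Qed.

Lemma integrable_excess : mu.-integrable setT (EFin \o excess).
Proof.
exact: (bounded_supp_integrable measurable_excess (measurable_norm_ball x0 r)).
Qed.

(** Taking positive parts does not increase differences, and the bump and [u]
    both have finite energy. *)
Lemma excess_energy : (energy s excess < +oo)%E.
Proof.
apply: (@energy_lin_le _ _ _ (bump x0 r) u excess (2 * eps ^+ 2) 2).
- exact: measurable_bump.
- exact: continuous_measurable_rV.
- exact: measurable_excess.
- by apply: bump_energy => //; exact: ltW.
- exact: homogeneous_sobolev_energy.
move=> x y; set p := bump x0 r x - bump x0 r y; set q := u x - u y.
rewrite -real_normK ?num_real // (@le_trans _ _ (`|eps * p - q| ^+ 2)) //.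
  rewrite lerXn2r ?nnegrE // (_ : eps * p - q =
    (eps * bump x0 r x - u x) - (eps * bump x0 r y - u y)).
    exact: ler_dist_max0.
  by rewrite /p /q; ring.
rewrite real_normK ?num_real // -subr_ge0.
rewrite [leRHS](_ : _ = (eps * p + q) ^+ 2) ?sqr_ge0 //; ring.
Qed.

Lemma excess_Hs : homogeneous_sobolev s excess.
Proof.
split.
  apply: (bounded_supp_in_Lp measurable_excess (measurable_norm_ball x0 r)
    B_fin _ normr_excess_le).
  by case/andP: s01 => s0 _; rewrite divr_gt0 ?mulr_gt0 ?subr_gt0 //
    (lt_trans _ n_gt2s) // mulr_gt0.
move: excess_energy; congr (_ < _)%E; apply: eq_integral => z _.
by rewrite real_normK ?num_real.
Qed.

Lemma excess_compact_support : compact (closure [set x | excess x != 0]).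
Proof.
have cB := compact_norm_ball (x := x0) (ltW r_gt0).
apply: (subclosed_compact _ cB); first exact: closed_closure.
have /closure_id -> := compact_closed (@norm_hausdorff _ _) cB.
by apply: closure_subset => x /= /excess_supp.
Qed.

Lemma integral_excess_gt0 : u x0 = 0 -> (0 < \int[mu]_x (excess x)%:E)%E.
Proof.
move=> ux0; pose t := eps * r ^+ 2 / 4.
have t_gt0 : 0 < t by rewrite divr_gt0.
have [rho1 rho1_gt0 urho1] : exists2 rho1 : R, 0 < rho1 &
    forall y, norm_ball x0 rho1 y -> - t <= - u y.
  apply: (@continuous_lower_bound _ _ (fun y => - u y)).
    by move=> y; apply: continuousN; exact: u_cont.
  by rewrite ux0 ltrN2.
pose rho := Num.min rho1 (r / (n%:R + 1)).
have n1_gt0 : 0 < n%:R + 1 :> R by rewrite ltr_wpDl.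
have rho_gt0 : 0 < rho by rewrite lt_min rho1_gt0 divr_gt0.
have t_le y : norm_ball x0 rho y -> t <= excess y.
  move=> By; have uy : u y <= t.
    rewrite -lerN2; apply: urho1; apply: le_trans By _.
    by rewrite ge_min lexx.
  have by2 : r ^+ 2 / 2 <= bump x0 r y.
    apply: le_trans (bump_ge _ _ _).
    have : sqnorm (y - x0) <= n%:R * (r / (n%:R + 1)) ^+ 2.
      apply: sqnorm_le; rewrite distrC; apply: le_trans By _.
      by rewrite ge_min lexx orbT.
    have : n%:R * (r / (n%:R + 1)) ^+ 2 <= r ^+ 2 / 2.
      rewrite expr_div_n mulrA ler_pdivrMr ?exprn_gt0 //.
      have n_ge0 : 0 <= n%:R :> R by [].
      have : 0 <= r ^+ 2 by exact: sqr_ge0.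
      by move: (r ^+ 2) n_ge0 => q h1 h2; nra.
    by lra.
  apply: le_trans (excess_ge y).
  have : eps * (r ^+ 2 / 2) <= eps * bump x0 r y by rewrite ler_wpM2l // ltW.
  by move: uy; rewrite /t; lra.
have mI : measurable_fun setT (fun x => (\1_(norm_ball x0 rho) x)%:E : \bar R).
  by apply/measurable_EFinP; exact: measurable_indic (measurable_norm_ball _ _).
apply: (@lt_le_trans _ _ (\int[mu]_x (t%:E * (\1_(norm_ball x0 rho) x)%:E))%E).
  rewrite ge0_integralZl_EFin ?(ltW t_gt0) //.
  rewrite integral_indic //; last exact: measurable_norm_ball.
  rewrite setIT [X in (_ * X)%E](lebesgue_norm_ball x0 (ltW rho_gt0)).
  by rewrite -EFinM lte_fin mulr_gt0 // exprn_gt0 // mulr_gt0.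
apply: ge0_le_integral => //.
- by move=> x _; rewrite mule_ge0 // lee_fin ltW.
- exact: emeasurable_funM.
- by apply/measurable_EFinP; exact: measurable_excess.
- move=> x _; rewrite -EFinM lee_fin indicE.
  have [/set_mem Bx|_] := boolP (x \in norm_ball x0 rho).
    by rewrite mulr1 t_le.
  by rewrite mulr0 excess_ge0.
Qed.

(** With v = eps * bump - u and v+ = [excess], the difference of the two sides is
    controlled by the inequality
    (v x - v y) (v+ x - v+ y) >= v+ x (v+ y - v y) + v+ y (v+ x - v x):
    the negative part v+ - v is at least [del] on [A], where the bump vanishes and
    [u] is at least [del]. *)
Lemma excess_form_le (A : set 'rV[R]_n) (del : R) x y :
  (forall z, A z -> ~ B z) -> (forall z, A z -> del <= u z) ->
  (u x - u y) * (excess x - excess y) <=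
    excess x * (eps * (bump x0 r x - bump x0 r y) - del * \1_A y) +
    excess y * (eps * (bump x0 r y - bump x0 r x) - del * \1_A x).
Proof.
move=> AB uA.
have neg z z' : excess z * (del * \1_A z') <=
    excess z * (excess z' - (eps * bump x0 r z' - u z')).
  apply: ler_wpM2l; rewrite ?excess_ge0 // indicE.
  have [/set_mem Az|_] := boolP (z' \in A); last first.
    by rewrite mulr0 subr_ge0 excess_ge.
  have -> : bump x0 r z' = 0.
    by apply/eqP/negPn/negP => /(bump_supp (ltW r_gt0)); exact: AB.
  by rewrite mulr1 mulr0; have := uA _ Az; have := excess_ge0 z'; lra.
have sq z : excess z * (excess z - (eps * bump x0 r z - u z)) = 0.
  have [->|ez] := eqVneq (excess z) 0; first by rewrite mul0r.
  by rewrite -excess_neq0 // subrr mulr0.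
have := neg x y; have := neg y x; have := sq x; have := sq y.
have := sqr_ge0 (excess x - excess y).
move: (excess x) (excess y) (bump x0 r x) (bump x0 r y) (u x) (u y).
by move: (\1_A x) (\1_A y) => k l p q a b e f; nra.
Qed.

Lemma potential_excess_le (c : 'rV[R]_n -> R) (M : R) : 0 <= M ->
  (\forall x \ae mu, B x -> `|c x| <= M) ->
  (\int[mu]_x (c x * u x * excess x)%:E <=
   (M * (eps * r ^+ 2))%:E * \int[mu]_x (excess x)%:E)%E.
Proof.
move=> M0 cM.
rewrite -(integralZl measurableT integrable_excess).
apply: (@integral_ae_le _ _ _ (fun x => M * (eps * r ^+ 2) * excess x)).
- by apply: measurable_funM => //; exact: measurable_excess.
- by move=> x; rewrite mulr_ge0 ?excess_ge0 // mulr_ge0 // ltW.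
apply: filterS cM => x cM.
have [->|ex] := eqVneq (excess x) 0; first by rewrite !mulr0.
rewrite ler_wpM2r ?excess_ge0 // (le_trans (ler_norm _)) // normrM.
rewrite (ger0_norm (u_ge0 x)) ler_pM ?le_excess_neq0 //.
exact/cM/excess_supp.
Qed.

End excess.

(** * The strong maximum principle *)

(** Testing with the excess of a bump of height of order [eps] around the zero [x0]:
    all terms are multiples of the integral of the test function.  The bump and the
    potential contribute at most a constant times [eps], whereas the positive values
    of [u] near [y0] contribute a negative constant independent of [eps]. *)
Lemma supersolution_touching_zero (R : realType) (N : nat) (s : R)
    (c u : 'rV[R]_N -> R) (x0 y0 : 'rV[R]_N) :
  0 < s -> s < 1 -> 2 * s < N%:R ->
  in_Linfty_loc c -> homogeneous_sobolev s u -> weak_supersolution s c u ->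
  continuous u -> (forall x, 0 <= u x) -> u x0 = 0 -> 0 < u y0 -> False.
Proof.
move=> s0 s1 N2s c_Linfty u_Hs u_super u_cont u_ge0 ux0 uy0.
have s01 : 0 < s < 1 by rewrite s0 s1.
have N0 : 0 < N%:R :> R by rewrite (lt_trans _ N2s) // mulr_gt0.
have xy0 : x0 != y0 by apply: contraTneq uy0 => <-; rewrite ux0 ltxx.
set d := `|x0 - y0|; have d0 : 0 < d by rewrite normr_gt0 subr_eq0.
pose r := Num.min 1 (d / 3).
have r0 : 0 < r by rewrite lt_min ltr01 divr_gt0.
have r1 : r <= 1 by rewrite ge_min lexx.
have rd : 3 * r <= d by rewrite mulrC -ler_pdivlMr // ge_min lexx orbT.
pose del := u y0 / 2; have del0 : 0 < del by rewrite divr_gt0.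
have [rho rho0 urho] : exists2 rho : R, 0 < rho &
    forall y, norm_ball y0 rho y -> del <= u y.
  apply: continuous_lower_bound => //.
  by rewrite ltr_pdivrMr // ltr_pMr // ltr1n.
pose r' := Num.min r rho; have r'0 : 0 < r' by rewrite lt_min r0 rho0.
have r'r : r' <= r by rewrite ge_min lexx.
pose A := norm_ball y0 r'; pose B := norm_ball x0 r.
have uA y : A y -> del <= u y.
  by move=> Ay; apply: urho; apply: le_trans Ay _; rewrite ge_min lexx orbT.
pose v := (2 * r') ^+ N; have v0 : 0 < v by rewrite exprn_gt0 // mulr_gt0.
have muA : lebesgue_rV N A = v%:E.
  by apply: lebesgue_norm_ball; exact: ltW.
have farAB x y : B x -> A y -> r <= `|x - y| <= 2 * d.
  rewrite /A /B /norm_ball /= => Bx Ay.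
  have h1 : d <= `|x0 - x| + `|x - y| + `|y0 - y|.
    rewrite /d (_ : x0 - y0 = (x0 - x) + (x - y) - (y0 - y)).
      by apply: le_trans (ler_normB _ _) _; rewrite lerD2r ler_normD.
    by apply/rowP => i; rewrite !mxE; ring.
  have h2 : `|x - y| <= `|x0 - x| + d + `|y0 - y|.
    rewrite /d (_ : x - y = (y0 - y) - ((x0 - x) - (x0 - y0))).
      apply: le_trans (ler_normB _ _) _; rewrite addrC lerD2r.
      exact: ler_normB.
    by apply/rowP => i; rewrite !mxE; ring.
  by apply/andP; split; lra.
have AB z : A z -> ~ B z.
  move=> Az Bz; have /andP[h _] := farAB _ _ Bz Az.
  by rewrite subrr normr0 leNgt r0 in h.
have [C0 C00 C0P] := integral_min1_kern N s01.
have [M M0 cM] := Linfty_loc_bound c_Linfty (compact_norm_ball (x := x0) (ltW r0)).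
pose m := (Num.sqrt (N%:R * (2 * d) ^+ 2) `^ (N%:R + 2 * s))^-1.
have m0 : 0 < m.
  by rewrite invr_gt0 powR_gt0 // sqrtr_gt0 mulr_gt0 // exprn_gt0 // mulr_gt0.
pose C : R := 2 * N%:R + 2 * r ^+ 2.
have C_ge0 : 0 <= C by rewrite addr_ge0 // mulr_ge0 // sqr_ge0.
(* [eps * E] is half of the nonlocal gain; the summand 1 of [E] makes the final
   inequality strict when the other two vanish. *)
pose E := C * C0 + M * r ^+ 2 + 1.
have E0 : 0 < E by rewrite ltr_wpDl // addr_ge0 // mulr_ge0 // sqr_ge0.
pose eps := del * (m * v) / E.
have eps0 : 0 < eps by rewrite divr_gt0 // !mulr_gt0.
have epsE : eps * E = del * (m * v) by rewrite mulfVK // gt_eqF.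
pose phi := excess u x0 r eps.
have mphi : measurable_fun setT phi by exact: measurable_excess.
have phi_ge0 x : 0 <= phi x by exact: excess_ge0.
have iphi : (lebesgue_rV N).-integrable setT (EFin \o phi).
  exact: integrable_excess.
have phi_Hs : homogeneous_sobolev s phi by exact: excess_Hs.
have super := u_super phi phi_Hs phi_ge0 (excess_compact_support u_ge0 r0).
have gag : (gagliardo_form s u phi <=
    (2 * (eps * (C * C0 / 2) - del * (m * v)))%:E *
    \int[lebesgue_rV N]_x (phi x)%:E)%E.
  have mmu : measurable_fun setT u by exact: continuous_measurable_rV.
  apply: (@gagliardo_form_le _ _ _ _ C0P (bump x0 r) phi A (r ^+ 2) C
    eps del m v r) => //.
  - exact: measurable_bump.
  - by move=> y; rewrite ger0_norm ?bump_ge0 // bump_le.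
  - exact: measurable_norm_ball.
  - exact: ltW.
  - exact: ltW.
  - exact: ltW.
  - by rewrite r0.
  - move=> x px y; apply: bump_semiconvex; exact: bump_excess_neq0 px.
  - move=> x y px Ay.
    have /andP[h1 h2] := farAB _ _ (excess_supp u_ge0 r0 px) Ay.
    split=> //; apply: kern_ge => //; first by rewrite ltr_wpDl // mulr_gt0.
    by rewrite -subr_eq0 -normr_gt0 (lt_le_trans r0).
  - by apply: integrable_gagliardo => //; exact: homogeneous_sobolev_energy.
  - by move=> x y; exact: excess_form_le.
have pot := potential_excess_le u_cont u_ge0 r0 eps0 M0 cM.
have : (0 < \int[lebesgue_rV N]_x (phi x)%:E)%E by exact: integral_excess_gt0.
have := le_trans super (leeD gag pot).
rewrite -/phi -(fineK (integrable_fin_num measurableT iphi)).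
rewrite lte_fin => le0 I0; move: le0.
rewrite -!EFinM -EFinD lee_fin -mulrDl pmulr_lge0 // leNgt => /negP; apply.
have : eps * E = eps * (C * C0) + eps * (M * r ^+ 2) + eps by rewrite /E; ring.
rewrite epsE.
have : 0 < del * (m * v) by rewrite !mulr_gt0.
rewrite (_ : M * (eps * r ^+ 2) = eps * (M * r ^+ 2)); last by ring.
rewrite (_ : eps * (C * C0 / 2) = eps * (C * C0) / 2); last by ring.
lra.
Qed.

Theorem lemma2p9 (R : realType) (N : nat) (s : R) (c u : 'rV[R]_N -> R)
    (s_gt0 : 0 < s) (s_lt1 : s < 1) (N_gt2s : 2 * s < N%:R)
    (c_Linfty_loc : in_Linfty_loc c)
    (u_Hs : homogeneous_sobolev s u)
    (u_super : weak_supersolution s c u)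
    (u_cont : continuous u)
    (u_ge0 : forall x, 0 <= u x) :
  (forall x, u x = 0) \/ (forall x, 0 < u x).
Proof.
have [u0|u_neq0] := pselect (forall x, u x = 0); [by left|right=> x].
rewrite lt_def u_ge0 andbT; apply/eqP => ux0; apply: u_neq0 => y.
apply/eqP/negPn/negP => uy.
have uy_gt0 : 0 < u y by rewrite lt_def uy u_ge0.
exact: (supersolution_touching_zero s_gt0 s_lt1 N_gt2s c_Linfty_loc u_Hs u_super
  u_cont u_ge0 ux0 uy_gt0).
Qed.
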